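(* Let $m \le n$ be positive integers, let $A \in \mathbb{Z}^{m \times n}$ and $b \in \mathbb{Z}^m$, and let $\tau$ be an $m$-element subset of $[n]=\{1,\ldots,n\}$ such that the $m \times m$ matrix $A_\tau$ is non-singular. If the linear Diophantine system $A x = b$, $x \in \mathbb{Z}^n$, is feasible, then it has a solution $x$ satisfying $$\|x\|_0 \le m + \Omega_m\left( \frac{|\det(A_\tau)|}{\gcd(A)} \right).$$ Moreover, under these assumptions, for given $A$, $b$ and $\tau$, such a sparse solution can be computed in polynomial time.
   Context: For $x\in\mathbb{R}^n$, $\|x\|_0 := |\{i : x_i \neq 0\}|$. For $\gamma \subseteq [n]$, $A_\gamma$ denotes the $m \times |\gamma|$ submatrix of $A$ formed by the columns indexed by $\gamma$. For $A \in \mathbb{Z}^{m\times n}$ of rank $m$, $\gcd(A)$ denotes the (positive) greatest common divisor of all the $m\times m$ minors $\det(A_\gamma)$, where $\gamma$ ranges over the $m$-element subsets of $[n]$. For a positive integer $z$ with prime factorization $z = p_1^{s_1}\cdots p_k^{s_k}$ (distinct primes $p_i$, multiplicities $s_i \ge 1$), $\Omega_m(z) := \sum_{i=1}^k \min\{s_i, m\}$ (so $\Omega_m(1)=0$). Polynomial time means polynomial in the binary encoding size of the input. *)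

(* Defs.v *)
From mathcomp Require Import all_boot all_order all_algebra.

Set Implicit Arguments.
Unset Strict Implicit.
Unset Printing Implicit Defensive.

Import GRing.Theory.
Local Open Scope ring_scope.

Definition norm0 n (x : 'cV[int]_n) : nat := #|[set i | x i 0 != 0]|.

Definition cols m n (A : 'M[int]_(m, n)) (g : {set 'I_n}) : 'M[int]_(m, #|g|) :=
  colsub (fun j : 'I_#|g| => enum_val j) A.

(* The determinant of [cols A g] when #|g| = m. The types 'M_(m, #|g|) and    *)
(* 'M_m are then only provably equal, hence [conform_mx]; the junk value      *)
(* \det 0 used when #|g| != m never matters below.                            *)
Definition minor m n (A : 'M[int]_(m, n)) (g : {set 'I_n}) : int :=
  \det (conform_mx (0 : 'M[int]_m) (cols A g)).

Definition gcd_minors m n (A : 'M[int]_(m, n)) : nat :=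
  \big[gcdn/0%N]_(g : {set 'I_n} | #|g| == m) `|minor A g|%N.

Definition Omega (m z : nat) : nat :=
  (\sum_(p <- primes z) minn (logn p z) m)%N.

Definition sparse_solution m n (A : 'M[int]_(m, n)) (b : 'cV[int]_m)
    (tau : {set 'I_n}) (x : 'cV[int]_n) : Prop :=
  A *m x = b /\ (norm0 x <= m + Omega m (`|minor A tau| %/ gcd_minors A))%N.

(* Computation model: a random access machine over the integers (with         *)
(* indirect addressing and structured control) under the logarithmic cost     *)
(* criterion. Every value occurring in an evaluation, be it an operand, an    *)
(* address, the content of a cell or a result, is charged its bit length, so  *)
(* that running times agree with those of Turing machines up to a polynomial. *)

(* One sign bit and the binary digits of the absolute value (one digit for 0) *)
Definition bitlen (z : int) : nat := (trunc_log 2 `|z|%N).+2.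

Definition bitsize (w : seq int) : nat := (\sum_(z <- w) bitlen z)%N.

Inductive binop := Add | Sub | Mul | Div.

Inductive expr :=
  | Cst of int
  | Get of expr
  | Bin of binop & expr & expr.

Inductive cmd :=
  | Skip
  | Assign of expr & expr
  | Seq of cmd & cmd
  | If of expr & cmd & cmd
  | While of expr & cmd.

(* Cells are addressed by arbitrary integers; since an input sits at the      *)
(* addresses 0, 1, ..., the negative addresses are initially free.            *)
Definition store := int -> int.

Definition eval_op (o : binop) (x y : int) : int :=
  match o with
  | Add => x + y
  | Sub => x - y
  | Mul => x * y
  | Div => (x %/ y)%Z
  end.

Fixpoint eval (s : store) (e : expr) : int :=
  match e with
  | Cst z => z
  | Get a => s (eval s a)
  | Bin o e1 e2 => eval_op o (eval s e1) (eval s e2)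
  end.

Fixpoint cost (s : store) (e : expr) : nat :=
  (bitlen (eval s e) +
   match e with
   | Cst _ => 0
   | Get a => cost s a
   | Bin _ e1 e2 => cost s e1 + cost s e2
   end)%N.

(* [exec c s t s']: started in s, the program c halts in s' after time t.     *)
(* Tests succeed on positive values.                                          *)
Inductive exec : cmd -> store -> nat -> store -> Prop :=
  | exec_skip s : exec Skip s 1 s
  | exec_assign s a e :
      exec (Assign a e) s (cost s a + cost s e) [eta s with eval s a |-> eval s e]
  | exec_seq c1 c2 s1 s2 s3 t1 t2 :
      exec c1 s1 t1 s2 -> exec c2 s2 t2 s3 ->
      exec (Seq c1 c2) s1 (t1 + t2) s3
  | exec_if_true e c1 c2 s t s' :
      0 < eval s e -> exec c1 s t s' -> exec (If e c1 c2) s (cost s e + t) s'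
  | exec_if_false e c1 c2 s t s' :
      ~~ (0 < eval s e) -> exec c2 s t s' ->
      exec (If e c1 c2) s (cost s e + t) s'
  | exec_while_true e c s1 s2 s3 t1 t2 :
      0 < eval s1 e -> exec c s1 t1 s2 -> exec (While e c) s2 t2 s3 ->
      exec (While e c) s1 (cost s1 e + t1 + t2) s3
  | exec_while_false e c s :
      ~~ (0 < eval s e) -> exec (While e c) s (cost s e) s.

Definition init_store (w : seq int) : store :=
  fun a => if a is Posz k then w`_k else 0.

Definition computes_within (P : cmd) (w : seq int) (T : nat) (y : seq int) :
    Prop :=
  exists t (s : store),
    [/\ exec P (init_store w) t s, (t <= T)%N
      & forall k : nat, (k < size y)%N -> s k%:Z = y`_k].

(* m, n, the entries of A row by row, those of b, and the indices in tau     *)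
(* in increasing order (columns being numbered from 0).                       *)
Definition encode_input m n (A : 'M[int]_(m, n)) (b : 'cV[int]_m)
    (tau : {set 'I_n}) : seq int :=
  [:: m%:Z; n%:Z] ++ [seq A i j | i <- enum 'I_m, j <- enum 'I_n]
    ++ [seq b i 0 | i <- enum 'I_m] ++ [seq (val j)%:Z | j <- enum tau].

Definition encode_vector n (x : 'cV[int]_n) : seq int :=
  [seq x i 0 | i <- enum 'I_n].

(* Main.v *)
(* Take S inclusion-minimal such that b lies in the lattice generated by the  *)
(* columns of A in S and tau. In coordinates with respect to a basis of that  *)
(* lattice, A_tau becomes a matrix q whose determinant divides                *)
(* |det A_tau| / gcd(A), and p ^ (m - rank of q mod p) divides det q for      *)
(* every prime p. Hence min(v_p, m) columns of S suffice to span together     *)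
(* with tau modulo p, where v_p is the multiplicity of p. The union over all  *)
(* p of these columns spans the lattice, so it is S by minimality.            *)
(*   Such an S is found by discarding columns as long as the system stays     *)
(* solvable. The Faddeev-LeVerrier algorithm gives an integer matrix E with   *)
(* E A_tau = d I, where d is a square, so that Ax = b is equivalent to        *)
(* E A x = E b, and solvability on S and tau amounts to solvability on S      *)
(* modulo d. The latter is decided by Euclidean elimination modulo d, which   *)
(* keeps all intermediate numbers below d.                                    *)
Require Import Defs.
From mathcomp Require Import all_boot all_order all_algebra fingroup perm zify ring.

Set Implicit Arguments.
Unset Strict Implicit.
Unset Printing Implicit Defensive.

Import Order.TTheory GRing.Theory Num.Theory.
Local Open Scope ring_scope.

(** * Minimal supports *)

(** Let S be minimal and T its union with tau. The lattice generated by the columns of A in T has a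
    basis L; let Q hold the coordinates of these columns and q those of tau ([lattice_basis]). Then
    det A_tau = det L * det q. The basis vectors are integer combinations of columns of A, so gcd(A)
    divides det L by Cauchy-Binet ([det_mulmx_dvd]), and det q divides D = |det A_tau| / gcd(A).
    Modulo a prime p the matrix Q has rank m, and q loses at most v_p(det q) of it, by the Smith
    form ([corank_mod_le_logn]); so at most min(v_p(D), m) columns complete tau to full rank
    ([extend_rank]). The columns chosen for all primes dividing D, together with tau, have full rank
    modulo every prime, hence a right inverse over the integers ([right_inverse_of_mod]), and
    generate the whole lattice. Minimality puts S inside this choice: [minimal_support_card].

    A minimal S is found greedily. Multiplying the system by a multiple of the inverse of A_tau,
    computed without fractions ([fl_spec]), makes the columns of tau vanish modulo d, so that only a
    system modulo d has to be decided on S ([feasible_mod], [lift_solution]). Euclidean elimination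
    with entries between 0 and d decides it: [sound_solution] shows that a reported solution is one,
    [spanned_end] that none is missed. The program is written in a small loop language;
    [compile_correct] turns a weakest precondition, which includes bounds on all values, into a run
    of the machine, whose time is polynomial in the word length ([poly_bounded_time]). *)

Lemma det_mulmx_expand m n (A : 'M[int]_(m, n)) (W : 'M[int]_(n, m)) :
  \det (A *m W) =
    \sum_(f : {ffun 'I_m -> 'I_n}) (\prod_i W (f i) i) * \det (colsub f A).
Proof.
rewrite -det_tr {1}/determinant.
transitivity (\sum_(s : 'S_m) (-1) ^+ s *
   \sum_(f : {ffun 'I_m -> 'I_n}) \prod_i (A (s i) (f i) * W (f i) i)).
  apply: eq_bigr => s _; congr (_ * _).
  rewrite -(bigA_distr_bigA (fun i j => A (s i) j * W j i)) /=.
  by apply: eq_bigr => i _; rewrite !mxE.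
rewrite (eq_bigr _ (fun s _ => mulr_sumr _ _ _ _)) exchange_big /=.
apply: eq_bigr => f _; rewrite -[\det _]det_tr /determinant mulr_sumr.
apply: eq_bigr => s _; rewrite big_split /= mulrA mulrC; congr (_ * _).
by congr (_ * _); apply: eq_bigr => i _; rewrite !mxE.
Qed.

(** Replaces the minor of a set by that of an increasing enumeration [f] of it, which avoids the
    cast hidden in [conform_mx]. *)
Lemma minorE m n (A : 'M[int]_(m, n)) (g : {set 'I_n}) : #|g| = m ->
  exists2 f : 'I_m -> 'I_n, g = [set f i | i in 'I_m]
      /\ (forall j0 i, f i = nth j0 (enum g) i) & minor A g = \det (colsub f A).
Proof.
move=> gm; subst m; exists (fun i => enum_val i); last by rewrite /minor conform_mx_id.
split=> [|j0 i]; last exact: enum_val_nth.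
apply/setP => j; apply/idP/imsetP => [jg|[i _ ->]]; last exact: enum_valP.
by exists (enum_rank_in jg j) => //; rewrite enum_rankK_in.
Qed.

(** A repeated column makes the determinant zero; otherwise the columns are those of a set up to a
    permutation, which only affects the sign. *)
Lemma det_colsub_dvd m n (A : 'M[int]_(m, n)) (f : 'I_m -> 'I_n) :
  (gcd_minors A %| `|\det (colsub f A)|)%N.
Proof.
case: (altP (@injectiveP _ _ f)) => [f_inj|/injectivePn [i [j nij eij]]]; last first.
  rewrite -det_tr (determinant_alternate nij) ?absz0 ?dvdn0 // => k.
  by rewrite !mxE eij.
pose g := [set f i | i in 'I_m].
have gm : #|g| = m by rewrite card_imset // card_ord.
have [h [eg _] mg] := minorE A gm.
have : (gcd_minors A %| `|minor A g|)%N.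
  by rewrite /gcd_minors (bigD1 g) ?gm ?eqxx //= dvdn_gcdl.
have hf i : exists j, f i == h j.
  have : f i \in g by apply: imset_f.
  by rewrite eg => /imsetP [j _ ->]; exists j.
pose s0 i := xchoose (hf i).
have es i : f i = h (s0 i) by apply/eqP/(xchooseP (hf i)).
have s_inj : injective s0 by move=> i j e; apply: f_inj; rewrite !es e.
have -> : colsub f A = col_perm (perm s_inj) (colsub h A).
  by apply/matrixP => i j; rewrite !mxE permE -es.
by rewrite col_permE det_mulmx det_perm mg abszM abszX abszN1 exp1n muln1.
Qed.

(** Cauchy-Binet in its ungrouped form: by multilinearity the determinant is an integer combination
    of those of column selections of [A]. *)
Lemma det_mulmx_dvd m n (A : 'M[int]_(m, n)) (W : 'M[int]_(n, m)) :
  (gcd_minors A %| `|\det (A *m W)|)%N.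
Proof.
rewrite det_mulmx_expand -[gcd_minors A]/(`|(gcd_minors A)%:Z|%N) -dvdzE.
apply: rpred_sum => f _; rewrite dvdz_mull // dvdzE; exact: det_colsub_dvd.
Qed.

(** Selecting rows or columns by a 0/1 diagonal matrix keeps the format, so that different index
    sets give matrices of the same type. *)
Definition maskmx (R : pzSemiRingType) n (U : {set 'I_n}) : 'M[R]_n :=
  diag_mx (\row_j (j \in U)%:R).

Lemma row_mask (R : pzSemiRingType) n m (U : {set 'I_n}) (M : 'M[R]_(n, m)) i :
  row i (maskmx R U *m M) = if i \in U then row i M else 0.
Proof.
apply/rowP => j; rewrite /maskmx mul_diag_mx !mxE.
by case: (i \in U); rewrite !mxE ?mul1r ?mul0r.
Qed.

Lemma mask_sub (F : fieldType) n m k (U : {set 'I_n}) (M : 'M[F]_(n, m))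
    (X : 'M[F]_(k, m)) :
  (forall i, i \in U -> (row i M <= X)%MS) -> (maskmx F U *m M <= X)%MS.
Proof.
move=> h; apply/row_subP => i; rewrite row_mask.
by case: ifP => [/h //|_]; apply: sub0mx.
Qed.

Lemma row_sub_mask (F : fieldType) n m (U : {set 'I_n}) (M : 'M[F]_(n, m)) i :
  i \in U -> (row i M <= maskmx F U *m M)%MS.
Proof. by move=> iU; apply: (submx_trans _ (row_sub i _)); rewrite row_mask iU. Qed.

(** Completion to a generating set: as long as the rank is below [m], some row in [T] lies outside
    the span, and adding it raises the rank. The induction is on a bound for the missing rank. *)
Lemma extend_rank (F : fieldType) n m (M : 'M[F]_(n, m)) (T U : {set 'I_n}) :
  U \subset T -> \rank (maskmx F T *m M) = m ->
  exists V : {set 'I_n}, [/\ V \subset T :\: U, (#|V| <= m - \rank (maskmx F U *m M))%N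
              & \rank (maskmx F (U :|: V) *m M) = m].
Proof.
move=> + rT; move: {2}(m - _)%N (leqnn (m - \rank (maskmx F U *m M))) => k.
elim: k U => [|k IH] U hk UT.
  exists set0; rewrite sub0set cards0 setU0; split=> //; apply/eqP.
  by rewrite eqn_leq rank_leq_col -subn_eq0 -leqn0.
have [e|ne] := eqVneq (\rank (maskmx F U *m M)) m.
  by exists set0; rewrite sub0set cards0 setU0.
have [j jT nj] : exists2 j, j \in T & ~~ (row j M <= maskmx F U *m M)%MS.
  apply/exists_inP; rewrite -negb_forall_in; apply/negP => /forall_inP h.
  have := mxrankS (mask_sub h); rewrite rT => h'.
  by move: ne; rewrite eqn_leq rank_leq_col h'.
have jU : j \notin U by apply: contra nj => /row_sub_mask.
have lt : (\rank (maskmx F U *m M) < \rank (maskmx F (j |: U) *m M))%N.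
  apply: rank_ltmx; rewrite ltmxE; apply/andP; split.
    by apply: mask_sub => i iU; apply: row_sub_mask; rewrite inE iU orbT.
  apply: contra nj; apply: submx_trans; apply: row_sub_mask.
  by rewrite !inE eqxx.
have lem := rank_leq_col (maskmx F (j |: U) *m M).
have [||V [VT cV rV]] := IH (j |: U); first lia.
  by rewrite subUset sub1set jT.
exists (j |: V); split.
- rewrite subUset sub1set inE jU jT /=; apply: subset_trans VT _.
  by apply: setDS; apply: subsetUr.
- by rewrite cardsU1; move: cV; case: (j \notin V) => /=; lia.
by rewrite setUCA setUA.
Qed.

(** * Reduction modulo primes and the Smith normal form *)

Definition mod_mx (p m n : nat) (A : 'M[int]_(m, n)) : 'M['F_p]_(m, n) :=
  map_mx intr A.

Lemma mod_mxM p m n k (A : 'M[int]_(m, n)) (B : 'M[int]_(n, k)) :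
  mod_mx p (A *m B) = mod_mx p A *m mod_mx p B.
Proof. exact: map_mxM. Qed.

Lemma mod_mx_mask p n (U : {set 'I_n}) : mod_mx p (maskmx int U) = maskmx 'F_p U.
Proof.
apply/matrixP => i j; rewrite !mxE.
by case: (i == j); case: (i \in U).
Qed.

Lemma intr_Fp_eq0 p (z : int) : prime p -> ((z%:~R : 'F_p) == 0) = (p %| `|z|)%N.
Proof. by move=> pp; rewrite -(dvdz_pcharf (pchar_Fp pp)) dvdzE. Qed.

(** Adding the indicator [e] of the zero entries makes the diagonal matrix invertible, and
    [diag_mx e] has rank at most the number of zeros. *)
Lemma rank_diag_ge (F : fieldType) m (d : 'rV[F]_m) :
  (m - #|[set i : 'I_m | d 0%R i == 0%R]| <= \rank (diag_mx d))%N.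
Proof.
pose e : 'rV[F]_m := \row_i (d 0 i == 0)%:R.
have h : \rank (diag_mx (d + e)) = m.
  apply: mxrank_unit; rewrite unitmxE det_diag unitfE; apply/prodf_neq0 => i _.
  rewrite !mxE; have [->|] := eqVneq (d 0 i) 0; first by rewrite add0r oner_eq0.
  by rewrite addr0.
have h2 : (\rank (diag_mx e) <= #|[set i : 'I_m | d 0%R i == 0%R]|)%N.
  rewrite diag_mx_sum_delta -sum1_card [in leqRHS]big_mkcond /=.
  apply: (big_ind2 (fun (N : 'M[F]_m) k => (\rank N <= k)%N)) => [|? ? ? ? k1 k2|i _].
  - by rewrite mxrank0.
  - exact: leq_trans (mxrank_add _ _) (leq_add k1 k2).
  - rewrite !mxE inE; case: ifP => _; last by rewrite scale0r mxrank0.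
    by rewrite scale1r mxrank_delta.
have := mxrank_add (diag_mx d) (diag_mx e); rewrite -raddfD /= h leq_subLR => /leq_trans; apply.
by rewrite addnC leq_add2r.
Qed.

Lemma smith_diag m n (M : 'M[int]_(m, n)) :
  exists (L : 'M[int]_m) (R : 'M[int]_n) (d : seq int),
    [/\ L \in unitmx, R \in unitmx
      & M = L *m (\matrix_(i, j) (d`_i *+ (i == j :> nat))) *m R].
Proof. by have [L Lu [R Ru [d _ e]]] := int_Smith_normal_form M; exists L, R, d. Qed.

Lemma abszdet_unit m (L : 'M[int]_m) : L \in unitmx -> `|\det L|%N = 1%N.
Proof. by rewrite unitmxE; case: (\det L) => [] [|[]]. Qed.

(** In Smith form the corank modulo [p] is at most the number of diagonal entries divisible by [p],
    each of which contributes a factor [p] to the determinant. *)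
Lemma corank_mod_le_logn p m (q : 'M[int]_m) : prime p -> \det q != 0 ->
  (m - \rank (mod_mx p q) <= logn p `|\det q|)%N.
Proof.
move=> pp dq; have [L [R [d [Lu Ru eq]]]] := smith_diag q.
pose dv := (\row_(i < m) d`_i).
have eD : (\matrix_(i, j) (d`_i *+ (i == j :> nat))) = diag_mx dv.
  by apply/matrixP => i j; rewrite !mxE.
rewrite {}eD in eq.
have rk : (\rank (diag_mx (map_mx intr dv : 'rV['F_p]_m)) <= \rank (mod_mx p q))%N.
  have -> : diag_mx (map_mx intr dv) = mod_mx p (invmx L *m q *m invmx R).
    by rewrite -map_diag_mx eq !mulmxA mulVmx // mul1mx -mulmxA mulmxV // mulmx1.
  rewrite !mod_mxM; apply: leq_trans (mxrankM_maxl _ _) _.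
  exact: mxrankM_maxr.
have {rk} := leq_trans (rank_diag_ge _) rk; set Z := [set _ | _] => rk.
have dq' : `|\det q|%N = (\prod_i `|dv 0%R i|)%N.
  rewrite eq !det_mulmx !abszM (abszdet_unit Lu) (abszdet_unit Ru) mul1n muln1 det_diag.
  by apply: (big_morph absz abszM).
rewrite -pfactor_dvdn ?absz_gt0 //.
apply: (@dvdn_trans (p ^ #|Z|)); first by rewrite dvdn_exp2l //; lia.
rewrite dq' -sum1_card expn_sum [X in (X %| _)%N]big_mkcond /=.
apply: (big_ind2 (fun k l => (k %| l)%N)) => // [? ? ? ?|i _]; first exact: dvdn_mul.
case: ifP; rewrite ?dvd1n // inE mxE intr_Fp_eq0 // expn1.
Qed.

(** A prime dividing a diagonal entry of the Smith form [D] would annihilate a row of [D] modulo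
    that prime. So these entries are 1 or -1, and the transpose of [D] is a right inverse of it. *)
Lemma right_inverse_of_mod m n (N : 'M[int]_(m, n)) :
  (forall p, prime p -> \rank (mod_mx p N) = m) -> exists W, N *m W = 1%:M.
Proof.
move=> h; have [L [R [d [Lu Ru eN]]]] := smith_diag N.
set D := \matrix_(i, j) _ in eN.
have hD p : prime p -> row_free (mod_mx p D).
  move=> pp; rewrite -row_leq_rank -{1}(h p pp) eN !mod_mxM.
  apply: leq_trans (mxrankM_maxl _ _) _; exact: mxrankM_maxr.
have hd p (i : 'I_m) : prime p -> row i (mod_mx p D) != 0.
  move=> pp; apply/negP => /eqP; rewrite rowE => /eqP.
  rewrite mulmx_free_eq0 ?hD // => /eqP /matrixP /(_ 0 i).
  by rewrite !mxE !eqxx => /eqP; rewrite oner_eq0.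
have mn : (m <= n)%N by rewrite -(h 2) // rank_leq_col.
have d1 (i : 'I_m) : d`_i * d`_i = 1.
  pose z : int := d`_i; rewrite -[d`_i]/z.
  suff : `|z|%N = 1%N by lia.
  apply/eqP; apply: contraT => ne.
  have [p pp pd] : exists2 p, prime p & (p %| `|z|)%N.
    (* Zero is divisible by every prime, and 2 is taken; otherwise a prime divisor exists because
       the absolute value is not 1. *)
    have [z0|z0] := eqVneq z 0; first by exists 2; rewrite // z0 absz0.
    by exists (pdiv `|z|%N); [apply: pdiv_prime; move: z0 ne; lia|apply: pdiv_dvd].
  have /eqP[] := hd p i pp; apply/rowP => j; rewrite !mxE.
  case: eqP => _; rewrite ?mulr0n ?mulr1n //; apply/eqP.
  by rewrite intr_Fp_eq0.
exists (invmx R *m D^T *m invmx L).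
suff DD : D *m D^T = 1%:M.
  by rewrite eN !mulmxA -[_ *m R *m _]mulmxA mulmxV // mulmx1 -[_ *m D *m _]mulmxA DD
    mulmx1 mulmxV.
apply/matrixP => i j; rewrite !mxE (bigD1 (widen_ord mn i)) //= !mxE eqxx mulr1n.
rewrite big1 ?addr0 => [|k ki]; last first.
  rewrite !mxE (_ : (i == k :> nat) = false) ?mulr0n ?mul0r //.
  by apply/negbTE; apply: contra ki => /eqP e; apply/eqP/val_inj.
have -> : (i == j) = (j == i :> nat) by rewrite eq_sym.
have [/val_inj ->|_] := eqVneq (j : nat) i; first by rewrite mulr1n d1.
by rewrite mulr0n mulr0.
Qed.

(** * The lattice generated by the columns and minimal supports *)

Definition feasible m n (A : 'M[int]_(m, n)) (b : 'cV[int]_m) (T : {set 'I_n}) :=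
  exists x : 'cV[int]_n, A *m x = b /\ forall j, j \notin T -> x j 0 = 0.

Lemma mask_out (R : pzSemiRingType) n (T : {set 'I_n}) (x : 'cV[R]_n) :
  (forall j, j \notin T -> x j 0 = 0) -> maskmx R T *m x = x.
Proof.
move=> h; apply/colP => j; rewrite /maskmx mul_diag_mx !mxE.
by case: (boolP (j \in T)) => [|/h ->]; rewrite ?mul1r // mulr0.
Qed.

(* The lattice generated by the columns of A in T has a basis L, in which     *)
(* these columns have coordinates Q.                                          *)
Lemma lattice_basis m n (A : 'M[int]_(m, n)) (T : {set 'I_n}) (f : 'I_m -> 'I_n) :
  (m <= n)%N -> (forall i, f i \in T) -> \det (colsub f A) != 0 ->
  exists (L : 'M[int]_m) (Q : 'M[int]_(m, n)) (W : 'M[int]_(n, m)),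
    [/\ A *m maskmx int T = L *m Q, Q *m W = 1%:M,
       colsub f A = L *m colsub f Q & \det L != 0].
Proof.
move=> mn fT dA; have [L [R [d [Lu Ru e]]]] := smith_diag (A *m maskmx int T).
set D := \matrix_(i, j) _ in e.
pose J : 'M[int]_(m, n) := pid_mx m.
(* As [m <= n], the Smith form is a square diagonal matrix times [J], which consists of the first
   [m] rows of the identity. The square part goes into the basis and [J *m R] is right
   invertible. *)
have eD : D = diag_mx (\row_i d`_i) *m J.
  apply/matrixP => i j; rewrite mul_diag_mx !mxE ltn_ord andbT.
  by case: eqP; rewrite ?mulr1n ?mulr1 ?mulr0n ?mulr0.
have eA : A *m maskmx int T = (L *m diag_mx (\row_i d`_i)) *m (J *m R).
  by rewrite e eD !mulmxA.
have ef : colsub f A = (L *m diag_mx (\row_i d`_i)) *m colsub f (J *m R).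
  apply/matrixP => i j; move/matrixP/(_ i (f j)): eA.
  rewrite !mxE (bigD1 (f j)) //= big1 => [|k kj]; last first.
    by rewrite !mxE (negbTE kj) mulr0.
  rewrite !mxE eqxx fT mulr1 addr0 => ->.
  by apply: eq_bigr => k _; rewrite !mxE.
exists (L *m diag_mx (\row_i d`_i)), (J *m R), (invmx R *m pid_mx m); split=> //.
  rewrite mulmxA -(mulmxA J) mulmxV // mulmx1 /J mul_pid_mx minnn.
  by rewrite (minn_idPr mn) pid_mx_1.
by apply: contra dA => /eqP dL; rewrite ef det_mulmx dL mul0r.
Qed.

(** Multiplying by the adjugate gives the equality up to the nonzero factor [\det L], which cancels
    in the integers. *)
Lemma mulmx_detI m n (L : 'M[int]_m) (X Y : 'M[int]_(m, n)) :
  \det L != 0 -> L *m X = L *m Y -> X = Y.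
Proof.
move=> dL /(congr1 (mulmx (\adj L))); rewrite !mulmxA mul_adj_mx !mul_scalar_mx.
move=> e; apply/matrixP => i j; apply: (mulfI dL).
by move/matrixP/(_ i j): e; rewrite !mxE.
Qed.

Lemma minimal_support_card m n (A : 'M[int]_(m, n)) (b : 'cV[int]_m)
    (tau S : {set 'I_n}) :
  (m <= n)%N -> #|tau| = m -> minor A tau != 0 -> feasible A b (S :|: tau) ->
  (forall j, j \in S -> ~ feasible A b (S :\ j :|: tau)) ->
  (#|S| <= Omega m (`|minor A tau| %/ gcd_minors A))%N.
Proof.
move=> mn taum; have [f [etau _] ->] := minorE A taum => dA [x [Ax xT]] Smin.
set T := S :|: tau in Ax xT.
have ftau i : f i \in tau by rewrite etau imset_f.
have fT i : f i \in T by rewrite inE ftau orbT.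
have [L [Q [W [eA QW ef dL]]]] := lattice_basis mn fT dA.
set q := colsub f Q in ef.
have dLq : \det (colsub f A) = \det L * \det q by rewrite ef det_mulmx.
have dq : \det q != 0 by apply: contra dA => /eqP h; rewrite dLq h mulr0.
set D := (_ %/ _)%N.
(* The basis [L] lies in the lattice, so it is [A] times an integer matrix. *)
have gL : (gcd_minors A %| `|\det L|)%N.
  have -> : L = A *m (maskmx int T *m W) by rewrite mulmxA eA -mulmxA QW mulmx1.
  exact: det_mulmx_dvd.
have qD : (`|\det q| %| D)%N.
  by rewrite /D dLq abszM mulnC -muln_divA // dvdn_mulr.
have D0 : (0 < D)%N.
  have g0 : (0 < gcd_minors A)%N by apply: dvdn_gt0 gL; rewrite absz_gt0.
  rewrite divn_gt0 // dvdn_leq ?absz_gt0 // dLq abszM.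
  exact: dvdn_mulr.
(* The coordinates [Q] vanish outside [T], so restricting them to [T] loses no rank. *)
have QT : Q *m maskmx int T = Q.
  apply: (mulmx_detI dL); rewrite mulmxA -eA -mulmxA; congr (_ *m _).
  rewrite /maskmx mulmx_diag; congr diag_mx; apply/rowP => j; rewrite !mxE.
  by case: (j \in T); rewrite ?mulr1 ?mulr0.
pose M p := (mod_mx p Q)^T.
have maskM p U : (maskmx 'F_p U *m M p)^T = mod_mx p (Q *m maskmx int U).
  by rewrite trmx_mul trmxK mod_mxM mod_mx_mask tr_diag_mx.
(* Primality is not assumed here: ['F_p] is a field for every natural [p]. *)
have rT p : \rank (maskmx 'F_p T *m M p) = m.
  rewrite -mxrank_tr maskM QT; apply/eqP/row_freeP; exists (mod_mx p W).
  by rewrite -mod_mxM QW; apply: map_mx1.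
have tauT : tau \subset T by apply: subsetUr.
pose good p (V : {set 'I_n}) :=
  [&& V \subset T :\: tau, (#|V| <= m - \rank (maskmx 'F_p tau *m M p))%N
    & \rank (maskmx 'F_p (tau :|: V) *m M p) == m].
have goodV p : exists V, good p V.
  have [V [h1 h2 h3]] := extend_rank tauT (rT p).
  by exists V; rewrite /good h1 h2 h3 eqxx.
pose V p := xchoose (goodV p).
have VT p : V p \subset T :\: tau by have /and3P[] := xchooseP (goodV p).
have Vrank p : \rank (maskmx 'F_p (tau :|: V p) *m M p) = m.
  by have /and3P[_ _ /eqP] := xchooseP (goodV p).
have Vcard p : prime p -> (#|V p| <= minn (logn p D) m)%N.
  move=> pp; have /and3P[_ + _] := xchooseP (goodV p); rewrite -/(V p) => h.
  rewrite leq_min (leq_trans h (leq_subr _ _)) andbT.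
  apply: leq_trans h _; apply: leq_trans (dvdn_leq_log p D0 qD).
  apply: leq_trans (corank_mod_le_logn pp dq); apply: leq_sub2l.
  rewrite -[in leqLHS]mxrank_tr; apply: mxrankS; apply/row_subP => i.
  suff -> : row i (mod_mx p q)^T = row (f i) (M p) by apply: row_sub_mask.
  by apply/rowP => j; rewrite !mxE.
pose S' := \bigcup_(p <- primes D) V p.
have VS' p : prime p -> V p \subset S'.
  move=> pp; have [pD|pD] := boolP (p \in primes D).
    by rewrite /S' (big_rem p) //= subsetUl.
  (* For a prime not dividing [D] the bound on [#|V p|] is 0: there tau alone has full rank. *)
  rewrite -logn_gt0 lt0n negbK in pD.
  have := Vcard p pp; rewrite (eqP pD) min0n leqn0 cards_eq0 => /eqP ->.
  exact: sub0set.
(* The columns of [Q] in tau and [S'] have full rank modulo every prime, hence generate all integer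
   vectors. *)
have [W' NW'] : exists W', (Q *m maskmx int (tau :|: S')) *m W' = 1%:M.
  apply: right_inverse_of_mod => p pp.
  rewrite -maskM mxrank_tr; apply/eqP; rewrite eqn_leq rank_leq_col.
  rewrite -[in leqLHS](Vrank p) mxrankS // mask_sub // => i.
  rewrite inE => h; apply: row_sub_mask; rewrite inE; case/orP: h => [->//|iV].
  by rewrite (subsetP (VS' p pp)) // orbT.
have S'T : S' \subset T :\: tau.
  rewrite /S'; apply: (big_ind (fun X : {set 'I_n} => X \subset T :\: tau)) => //.
    exact: sub0set.
  by move=> X Y hX hY; rewrite subUset hX hY.
(* The coordinate vector [Q *m x] of [b] is rewritten through [W'] as a combination of the columns
   in tau and [S']. *)
have feasS' (U : {set 'I_n}) : S' \subset U -> feasible A b (U :|: tau).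
  move=> S'U; exists (maskmx int (tau :|: S') *m W' *m (Q *m x)); split.
    set y := _ *m (Q *m x).
    have yT : maskmx int T *m y = y.
      apply: mask_out => j jT; rewrite /y -mulmxA /maskmx mul_diag_mx !mxE.
      rewrite (_ : _ \in _ = false) ?mul0r //; apply: contraNF jT; rewrite inE.
      case/orP=> [|h]; first exact: (subsetP tauT).
      by have := subsetP S'T _ h; rewrite inE => /andP [].
    rewrite -yT mulmxA eA -mulmxA /y !mulmxA -(mulmxA L) -(mulmxA L) NW' mulmx1.
    by rewrite -eA -mulmxA mask_out.
  move=> j; rewrite -mulmxA /maskmx mul_diag_mx !mxE !inE => /norP [jU jt].
  rewrite (negbTE jt) (_ : j \in S' = false) ?mul0r //.
  by apply: contraNF jU => /(subsetP S'U).
(* If some [j] in [S] were outside [S'], then [S'] would lie in [S] without [j], which would still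
   be feasible. *)
have SS' : S \subset S'.
  apply/subsetP => j jS; apply: contraT => jS'; case: (Smin j jS); apply: feasS'.
  apply/subsetP => i iS'; have := subsetP S'T _ iS'; rewrite !inE.
  case: eqP => [e|_ /andP [it]]; first by rewrite -e iS' in jS'.
  by rewrite (negbTE it) orbF.
apply: leq_trans (subset_leq_card SS') _.
rewrite /Omega /S' big_seq [in leqRHS]big_seq.
apply: (big_ind2 (fun (X : {set 'I_n}) k => (#|X| <= k)%N)) => [|X k Y l hX hY|p].
- by rewrite cards0.
- exact: leq_trans (leq_card_setU X Y) (leq_add hX hY).
by rewrite mem_primes => /and3P [pp _ _]; apply: Vcard.
Qed.

(** * The Faddeev-LeVerrier algorithm *)

Lemma deriv_prod (R : comNzRingType) n (F : 'I_n -> {poly R}) :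
  (\prod_i F i)^`() = \sum_i \prod_j (if j == i then (F j)^`() else F j).
Proof.
elim: n F => [|n IH] F; first by rewrite !big_ord0 derivC.
rewrite big_ord_recl derivM IH [RHS]big_ord_recl; congr (_ + _).
  by rewrite big_ord_recl.
rewrite mulr_sumr; apply: eq_bigr => i _.
by rewrite [RHS]big_ord_recl; congr (_ * _).
Qed.

(** Jacobi's formula: the derivative of a determinant is the sum over [i] of the determinants with
    row [i] differentiated. Here that row becomes a unit vector, which leaves the diagonal
    cofactor. *)
Lemma deriv_char_poly (R : comNzRingType) n (B : 'M[R]_n) :
  (char_poly B)^`() = \tr (\adj (char_poly_mx B)).
Proof.
set A := char_poly_mx B.
pose D i : 'M[{poly R}]_n :=
  \matrix_(j, k) (if j == i then (A j k)^`() else A j k).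
transitivity (\sum_i \det (D i)).
  rewrite /char_poly /determinant raddf_sum exchange_big /=.
  apply: eq_bigr => s _; rewrite -mulr_sumr.
  have -> : ((-1) ^+ s : {poly R}) = ((-1) ^+ s)%:P by rewrite rmorph_sign.
  rewrite deriv_mulC deriv_prod; congr (_ * _).
  by apply: eq_bigr => i _; apply: eq_bigr => j _; rewrite [in RHS]mxE.
apply: eq_bigr => i _; rewrite (expand_det_row _ i) (bigD1 i) //= big1 => [|k ki].
  rewrite addr0 !mxE !eqxx mulr1n derivB derivX derivC subr0 mul1r.
  rewrite /cofactor; congr (_ * \det _).
  by apply/matrixP => j k; rewrite !mxE eq_sym (negbTE (neq_lift _ _)).
by rewrite !mxE eqxx eq_sym (negbTE ki) mulr0n sub0r derivN derivC oppr0 mul0r.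
Qed.

(** The division is exact at all the steps used, which the proof of [fl_spec] establishes; so the
    iteration stays within the integers. *)
Fixpoint fl_mat m (B : 'M[int]_m) (t : nat) : 'M[int]_m :=
  if t is t'.+1 then
    B *m fl_mat B t' + ((- \tr (B *m fl_mat B t')) %/ t%:Z)%Z%:M
  else 1%:M.

Definition fl_coef m (B : 'M[int]_m) (t : nat) : int :=
  ((- \tr (B *m fl_mat B t)) %/ t.+1%:Z)%Z.

(* Faddeev and LeVerrier: the matrices computed are the coefficients of the   *)
(* adjugate of X - B, because they satisfy the recurrence obtained from       *)
(* (X - B) adj(X - B) = chi_B, with chi_B' = tr adj (X - B) giving the        *)
(* coefficients of chi_B.                                                     *)
Lemma fl_spec m (B : 'M[int]_m.+1) :
  [/\ B *m fl_mat B m = (- fl_coef B m)%:M, fl_mat B m *m B = (- fl_coef B m)%:M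
    & (fl_coef B m == 0) = (\det B == 0)].
Proof.
set X := char_poly B.
(* [N k] is the matrix coefficient of degree [k] of the adjugate; comparing coefficients in its
   product with [X - B] gives [rec0] and [rec]. *)
pose N k : 'M[int]_m.+1 := \matrix_(i, j) (\adj (char_poly_mx B) i j)`_k.
have rec0 : B *m N 0%N = (- X`_0)%:M.
  apply/matrixP => i j; move/matrixP/(_ i j)/(congr1 (coefp 0)): (mul_mx_adj (char_poly_mx B)).
  rewrite /coefp /= !mxE coef_sum -/X coefMn => e.
  rewrite mulNrn -e -sumrN; apply: eq_bigr => k _.
  by rewrite !mxE mulrBl coefB mulrnAl coefMn coefXM coefCM mul0rn sub0r opprK.
have rec0' : N 0%N *m B = (- X`_0)%:M.
  apply/matrixP => i j; move/matrixP/(_ i j)/(congr1 (coefp 0)): (mul_adj_mx (char_poly_mx B)).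
  rewrite /coefp /= !mxE coef_sum -/X coefMn => e.
  rewrite mulNrn -e -sumrN; apply: eq_bigr => k _.
  by rewrite !mxE mulrBr coefB mulrnAr coefMn coefMX coefMC mul0rn sub0r opprK.
have rec k : N k = B *m N k.+1 + (X`_(k.+1))%:M.
  apply/matrixP => i j.
  move/matrixP/(_ i j)/(congr1 (coefp k.+1)): (mul_mx_adj (char_poly_mx B)).
  rewrite /coefp /= !mxE coef_sum -/X coefMn => <-.
  rewrite -big_split /= (bigD1 i) //= big1 ?addr0 => [|l li]; last first.
    by rewrite !mxE eq_sym (negbTE li) mulr0n sub0r mulNr coefN coefCM subrr.
  by rewrite !mxE eqxx mulr1n mulrBl coefB coefXM coefCM /= addrC subrK.
have sX : size X = m.+2 by apply: size_char_poly.
(* The coefficients vanish from some degree [K] on; above [m] the recurrence has no scalar term, so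
   the vanishing propagates downwards. *)
have Nlarge k : (m < k)%N -> N k = 0.
  have [K hK] : exists K, forall k, (K <= k)%N -> N k = 0.
    pose F (ij : 'I_m.+1 * 'I_m.+1) := size (\adj (char_poly_mx B) ij.1 ij.2).
    exists (\max_ij F ij)%N => l hl; apply/matrixP => i j; rewrite mxE [RHS]mxE.
    rewrite nth_default //; apply: leq_trans hl; exact: (leq_bigmax (F := F) (i, j)).
  have [/hK //|] := leqP K k; move: {2}(K - k)%N (leqnn (K - k)) => d.
  elim: d k => [|d IH] k; first by rewrite leqn0 subn_eq0 leqNgt => /negbTE ->.
  move=> hd kK mk; rewrite rec nth_default ?sX //.
  have -> : N k.+1 = 0.
    have [/hK //|lt] := leqP K k.+1; apply: IH => //; first by lia.
    exact: leq_trans mk _.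
  by rewrite mulmx0 add0r raddf0.
have Xm1 : X`_m.+1 = 1.
  by have /monicP := char_poly_monic B; rewrite lead_coefE -/X sX.
have trN k : \tr (N k) = X`_k.+1 *+ k.+1.
  rewrite -coef_deriv deriv_char_poly /mxtrace coef_sum.
  by apply: eq_bigr => i _; rewrite mxE.
(* The trace of the recurrence, with [trN] for the trace of [N k], isolates a multiple of the next
   coefficient of the characteristic polynomial. *)
have trBN k : (k <= m)%N -> \tr (B *m N k) = - (X`_k *+ (m.+1 - k)).
  case: k => [|k] km; first by rewrite rec0 mxtrace_scalar subn0 mulNrn.
  have /eqP := congr1 mxtrace (rec k).
  rewrite raddfD /= trN mxtrace_scalar -subr_eq => /eqP <-.
  by rewrite mulrnBr ?opprB // ltnW.
have divE (z : int) k : ((z *+ k.+1) %/ k.+1%:Z)%Z = z.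
  by rewrite -mulr_natr natz mulzK.
have subE t : (t <= m)%N -> (m.+1 - (m - t) = t.+1)%N by move=> tm; lia.
have main t : (t <= m)%N -> fl_mat B t = N (m - t)%N /\ fl_coef B t = X`_(m - t).
  have C : fl_mat B t = N (m - t)%N -> (t <= m)%N -> fl_coef B t = X`_(m - t).
    move=> e tm; rewrite /fl_coef e trBN ?leq_subr // opprK.
    by rewrite subE // divE.
  move=> tm; suff e : fl_mat B t = N (m - t)%N by split; [|apply: C].
  elim: t tm {C} => [|t IH] tm; first by rewrite subn0 rec Nlarge // mulmx0 add0r Xm1.
  have e := IH (ltnW tm).
  rewrite /= -/(fl_mat B t) (_ : (_ %/ _)%Z = X`_(m - t)).
    by rewrite e [RHS]rec subnSK.
  by rewrite e trBN ?leq_subr // opprK subE ?divE // ltnW.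
have [e1 e2] := main m (leqnn m); rewrite e1 e2 subnn; split=> //.
by rewrite char_poly_det mulf_eq0 expf_eq0 oppr_eq0 oner_eq0 andbF.
Qed.

(** * Linear systems modulo an integer *)

Section Solver.
Variables (m n : nat) (d : int) (C : nat -> nat -> int) (c : nat -> int).
Hypothesis d0 : 0 < d.
Implicit Types (S x w : nat -> int) (G : nat -> nat -> int).

Let dn0 : d != 0. Proof. by rewrite gt_eqF. Qed.

Definition mod_solution S x :=
  (forall j, (j < n)%N -> S j = 0 -> x j = 0) /\
  (forall k, (k < m)%N -> (d %| c k - \sum_(j < n) C k j * x j)%Z).

Definition mod_feasible S := exists x, mod_solution S x.

Lemma mod_solution_ext S S' x x' :
  (forall j, (j < n)%N -> S' j = 0 -> S j = 0) ->
  (forall j, (j < n)%N -> x' j = x j) -> mod_solution S x -> mod_solution S' x'.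
Proof.
move=> hS hx [h1 h2]; split=> [j jn /hS Sj|k km]; first by rewrite hx // h1 ?Sj.
rewrite (eq_bigr (fun j : 'I_n => C k j * x j)) ?h2 // => j _.
by rewrite hx.
Qed.

Lemma mod_feasible_mono S S' : (forall j, (j < n)%N -> S' j = 0 -> S j = 0) ->
  mod_feasible S -> mod_feasible S'.
Proof. by move=> h [x hx]; exists x; apply: mod_solution_ext hx. Qed.

(* Rows a < n of G are generators, row n is the pivot and row n.+1 is what    *)
(* remains of c. Columns from m on express the first m ones, modulo d, in     *)
(* terms of the columns of C. *)
Definition sound S G := forall a, (a < n.+2)%N ->
  [/\ forall k, (k < m + n)%N -> 0 <= G a k <= d,
      forall j, (j < n)%N -> S j = 0 -> G a (m + j)%N = 0
    & forall k, (k < m)%N -> (d %| G a k - (if a == n.+1 then c k else 0)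
                                 - \sum_(j < n) C k j * G a (m + j)%N)%Z].

(** Completeness invariant before column [i]: what remains of the right-hand side is a combination
    of the generators, up to multiples of [d] from column [i] on, but exactly in the columns before
    it. It therefore vanishes in those. *)
Definition spanned i G :=
  (forall a k, (a < n)%N -> (k < i)%N -> G a k = 0) /\
  exists x w, forall k, (k < m)%N ->
    G n.+1 k = \sum_(a < n) x a * G a k + (if (i <= k)%N then d * w k else 0).

(** The invariant while column [i] is being cleared, with generators before [j] done. The pivot row
    joins the combination, and column [i] is now exact too. *)
Definition pivoting i j G :=
  [/\ forall a k, (a < n)%N -> (k < i)%N -> G a k = 0,
      forall k, (k < i)%N -> G n k = 0,
      0 < G n i,
      forall a, (a < j)%N -> G a i = 0
    & exists x w u, forall k, (k < m)%N ->
        G n.+1 k = \sum_(a < n) x a * G a k + u * G n k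
                   + (if (i < k)%N then d * w k else 0)].

Lemma modzE (x : int) : (x %% d)%Z = x - d * (x %/ d)%Z.
Proof. by rewrite /modz mulrC. Qed.

Lemma modz_range (x : int) : 0 <= (x %% d)%Z <= d.
Proof. by rewrite modz_ge0 // ltW // ltz_pmod. Qed.

(** The relation to the columns of [C] is linear, and reducing any entry modulo [d], also among the
    coefficients, changes it by a multiple of [d]. *)
Lemma rel_comb (P V T e : nat -> int) q :
  (forall k, (k < m + n)%N -> T k = ((P k - q * V k) %% d)%Z) ->
  (forall k, (k < m)%N -> (d %| P k - e k - \sum_(j < n) C k j * P (m + j)%N)%Z) ->
  (forall k, (k < m)%N -> (d %| V k - 0 - \sum_(j < n) C k j * V (m + j)%N)%Z) ->
  forall k, (k < m)%N -> (d %| T k - e k - \sum_(j < n) C k j * T (m + j)%N)%Z.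
Proof.
move=> hT hP hV k km.
pose z l := ((P l - q * V l) %/ d)%Z.
have eT l : (l < m + n)%N -> T l = P l - q * V l - d * z l.
  by move=> lw; rewrite hT // modzE.
have -> : \sum_(j < n) C k j * T (m + j)%N =
   \sum_(j < n) C k j * P (m + j)%N - q * (\sum_(j < n) C k j * V (m + j)%N)
   - d * (\sum_(j < n) C k j * z (m + j)%N).
  rewrite !mulr_sumr -!sumrB; apply: eq_bigr => j _.
  rewrite eT ?ltn_add2l //; ring.
rewrite eT ?ltn_addr //.
have [[a ha] [b hb]] := (dvdzP (hP k km), dvdzP (hV k km)).
set s := \sum_(j < n) C k j * z _.
apply/dvdzP; exists (a - q * b - z k + s).
by rewrite !mulrDl !mulNr -(mulrA q) -ha -hb; ring.
Qed.

Definition start S (G : nat -> nat -> int) := forall a k, (a < n.+2)%N -> (k < m + n)%N ->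
  G a k = if (k < m)%N then
            if (a < n)%N then S a * (C k a %% d)%Z
            else if a == n.+1 then (c k %% d)%Z else 0
          else if k == (m + a)%N then S a else 0.

Lemma start_sound S G : (forall j, (j < n)%N -> S j = 0 \/ S j = 1) ->
  start S G -> sound S G.
Proof.
move=> hS hG a an; have S01 : (a < n)%N -> 0 <= S a <= 1.
  by move=> /hS [->|->].
have md (z : int) := modz_range z.
have d1 : 1 <= d by rewrite -gtz0_ge1.
split.
- move=> k kw; rewrite hG //; case: ifP => km.
    case: ifP => [/hS [->|->]|_]; rewrite ?mul0r ?mul1r ?md ?lexx ?(ltW d0) //.
    by case: ifP => _; rewrite ?md // lexx (ltW d0).
  case: eqP => [e|_]; last by rewrite lexx ltW.
  have an' : (a < n)%N by move: kw; rewrite e ltn_add2l.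
  by have /andP[-> h] := S01 an'; apply: le_trans h d1.
- move=> j jn Sj; rewrite hG ?ltn_add2l // ltnNge leq_addr /= eqn_add2l.
  by case: eqP => // <-.
move=> k km.
have bot j : (j < n)%N -> G a (m + j)%N = if j == a then S a else 0.
  by move=> jn; rewrite hG ?ltn_add2l // ltnNge leq_addr /= eqn_add2l.
rewrite hG ?ltn_addr // km.
case: (ltnP a n) => an'.
  rewrite (ltn_eqF (ltn_trans an' _)) ?subr0 // (bigD1 (Ordinal an')) //= big1.
    rewrite bot // eqxx addr0 modzE; apply/dvdzP; exists (- (S a * (C k a %/ d)%Z)).
    ring.
  by move=> j ja; rewrite bot // ifF ?mulr0 //; apply/negbTE.
rewrite big1 ?subr0 => [|j _]; last first.
  by rewrite bot // ltn_eqF ?mulr0 // (leq_trans (ltn_ord j)).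
case: eqP => _; last by rewrite subr0 dvdz0.
by rewrite modzE; apply/dvdzP; exists (- (c k %/ d)%Z); ring.
Qed.

Lemma start_spanned S G : (forall j, (j < n)%N -> S j = 0 \/ S j = 1) ->
  start S G -> mod_feasible S -> spanned 0 G.
Proof.
move=> hS hG [x [xS hx]]; split=> //.
(* The multiples of [d] come from the congruences solved by [x], from the reduction of [c] and from
   that of the columns of [C]. *)
exists x, (fun k => ((c k - \sum_(j < n) C k j * x j) %/ d)%Z - (c k %/ d)%Z
  + \sum_(a < n) x a * (C k a %/ d)%Z) => k km /=.
have h : c k = \sum_(j < n) C k j * x j
               + d * ((c k - \sum_(j < n) C k j * x j) %/ d)%Z.
  by rewrite mulrC divzK ?hx // addrC subrK.
set t := (_ %/ d)%Z in h *.
have -> : \sum_(a < n) x a * G a k =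
    \sum_(j < n) C k j * x j - d * \sum_(j < n) x j * (C k j %/ d)%Z.
  rewrite mulr_sumr -sumrB; apply: eq_bigr => j _.
  rewrite hG ?ltn_addr ?(leqW (leqW _)) // km ltn_ord modzE.
  by case: (hS j) => // Sj; rewrite Sj; [rewrite xS //|]; ring.
by rewrite hG ?ltn_addr // km ltnNge leqnSn /= eqxx modzE; set q := (c k %/ d)%Z; rewrite h; ring.
Qed.

Lemma row_sum i n' (F : nat -> int) : (i < n')%N ->
  \sum_(a < n') F a = F i + \sum_(a < n' | a != i :> nat) F a.
Proof. by move=> h; rewrite (bigD1 (Ordinal h)). Qed.

(** The pivot starts as [d] times a unit vector. This is zero modulo [d], hence sound, and it
    absorbs the slack [d * w i], which makes column [i] exact. *)
Lemma pivot_init S i G G' : (i < m)%N -> sound S G ->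
  (forall a k, (a < n.+2)%N -> (k < m + n)%N ->
     G' a k = if a == n then (if k == i then d else 0) else G a k) ->
  sound S G' /\ (spanned i G -> pivoting i 0 G').
Proof.
move=> im sG hG'; have iw : (i < m + n)%N by apply: ltn_addr.
split.
  move=> a an; have [h1 h2 h3] := sG a an; have nk j : (j < n)%N -> (m + j == i) = false.
    by move=> _; rewrite gtn_eqF // (leq_trans im) // leq_addr.
  case: (eqVneq a n) => [e|ne]; split.
  - move=> k kw; rewrite hG' // e eqxx; case: ifP => _; rewrite ?lexx ?(ltW d0) //.
  - by move=> j jn _; rewrite hG' ?ltn_add2l // e eqxx nk.
  - move=> k km; rewrite hG' ?ltn_addr // e eqxx (ltn_eqF (ltnSn n)) subr0.
    rewrite big1 ?subr0 => [|j _]; first by case: ifP => _; rewrite ?dvdzz ?dvdz0.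
    by rewrite hG' ?ltn_add2l // eqxx nk // mulr0.
  - by move=> k kw; rewrite hG' // (negbTE ne) h1.
  - by move=> j jn Sj; rewrite hG' ?ltn_add2l // (negbTE ne) h2.
  move=> k km; rewrite hG' ?ltn_addr // (negbTE ne).
  rewrite (eq_bigr (fun j : 'I_n => C k j * G a (m + j)%N)) ?h3 // => j _.
  by rewrite hG' ?ltn_add2l // (negbTE ne).
move=> [z [x [w e]]]; split.
- by move=> a k an ki; rewrite hG' ?(leqW (leqW _)) ?(ltn_trans ki) // (ltn_eqF an) z.
- by move=> k ki; rewrite hG' ?(ltn_trans ki) // eqxx (ltn_eqF ki).
- by rewrite hG' // !eqxx.
- by [].
exists x, w, (w i) => k km; rewrite !hG' ?ltn_addr // (gtn_eqF (ltnSn n)) eqxx e //.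
rewrite -addrA; congr (_ + _).
  apply: eq_bigr => a _; rewrite hG' ?ltn_addr ?(leqW (leqW _)) //.
  by rewrite (ltn_eqF (ltn_ord a)).
rewrite leq_eqVlt (eq_sym k i); case: eqP => [->|_] /=; last by rewrite mulr0 add0r.
by rewrite ltnn addr0 mulrC.
Qed.

(** One division with remainder in column [i], exchanging the pivot and generator [j]. It is the
    identity once the entry of the generator is zero, so it can be repeated a fixed number of
    times. *)
Definition euclid_step i j (G G' : nat -> nat -> int) := forall a k,
  (a < n.+2)%N -> (k < m + n)%N ->
  G' a k = if G j i == 0 then G a k
           else if a == j then ((G n k - (G n i %/ G j i)%Z * G j k) %% d)%Z
           else if a == n then G j k else G a k.

Lemma euclid_sound S i j G G' : (j < n)%N -> sound S G -> euclid_step i j G G' ->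
  sound S G'.
Proof.
move=> jn sG hG'; have [e0|ne0] := eqVneq (G j i) 0.
  have e a k : (a < n.+2)%N -> (k < m + n)%N -> G' a k = G a k.
    by move=> an kw; rewrite hG' // e0 eqxx.
  move=> a an; have [h1 h2 h3] := sG a an; split.
  - by move=> k kw; rewrite e ?h1.
  - by move=> l ln Sl; rewrite e ?ltn_add2l ?h2.
  move=> k km; rewrite e ?ltn_addr //.
  rewrite (eq_bigr (fun j : 'I_n => C k j * G a (m + j)%N)) ?h3 // => l _.
  by rewrite e ?ltn_add2l.
rewrite /euclid_step (negbTE ne0) in hG'.
have jn2 : (j < n.+2)%N by apply: ltn_trans jn _; apply: leqW.
have nn2 : (n < n.+2)%N by apply: leqW.
have [p1 p2 p3] := sG n nn2; have [q1 q2 q3] := sG j jn2.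
move=> a an; have [h1 h2 h3] := sG a an.
have [eaj|naj] := eqVneq a j.
  rewrite {}eaj in hG' h1 h2 h3 *.
  have e k : (k < m + n)%N -> G' j k = ((G n k - (G n i %/ G j i)%Z * G j k) %% d)%Z.
    by move=> kw; rewrite hG' // eqxx.
  split.
  - by move=> k kw; rewrite e // modz_range.
  - by move=> l ln Sl; rewrite e ?ltn_add2l // p2 // q2 // mulr0 subr0 mod0z.
  move=> k km; rewrite (ltn_eqF (ltn_trans jn _)) //.
  apply: (rel_comb (e := fun=> 0) e) => // l lm.
    by have := p3 l lm; rewrite (ltn_eqF (ltnSn n)).
  by have := q3 l lm; rewrite (ltn_eqF (ltn_trans jn _)).
have [ean|nan] := eqVneq a n.
  have e k : (k < m + n)%N -> G' a k = G j k.
    by move=> kw; rewrite hG' // (negbTE naj) ean eqxx.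
  split.
  - by move=> k kw; rewrite e ?q1.
  - by move=> l ln Sl; rewrite e ?ltn_add2l ?q2.
  move=> k km; rewrite e ?ltn_addr // (_ : (a == n.+1) = false); last first.
    by rewrite ean (ltn_eqF (ltnSn n)).
  rewrite (eq_bigr (fun l : 'I_n => C k l * G j (m + l)%N)).
    by have := q3 k km; rewrite (ltn_eqF (ltn_trans jn _)).
  by move=> l _; rewrite e ?ltn_add2l.
have e k : (k < m + n)%N -> G' a k = G a k.
  by move=> kw; rewrite hG' // (negbTE naj) (negbTE nan).
split.
- by move=> k kw; rewrite e ?h1.
- by move=> l ln Sl; rewrite e ?ltn_add2l ?h2.
move=> k km; rewrite e ?ltn_addr //.
rewrite (eq_bigr (fun j : 'I_n => C k j * G a (m + j)%N)) ?h3 // => l _.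
by rewrite e ?ltn_add2l.
Qed.

Lemma euclid_pivoting S i j G G' : (i < m)%N -> (j < n)%N -> sound S G ->
  euclid_step i j G G' -> pivoting i j G -> pivoting i j G'.
Proof.
move=> im jn sG hG' [z zp p0 zj [x [w [u hx]]]]; have [e0|ne0] := eqVneq (G j i) 0.
  have e a k : (a < n.+2)%N -> (k < m + n)%N -> G' a k = G a k.
    by move=> an kw; rewrite hG' // e0 eqxx.
  have ik k : (k < i)%N -> (k < m + n)%N by move=> /ltn_trans; apply; apply: ltn_addr.
  split.
  - by move=> a k an ki; rewrite e ?(leqW (leqW _)) ?z ?ik.
  - by move=> k ki; rewrite e ?zp ?ik.
  - by rewrite e ?ltn_addr.
  - move=> a aj; rewrite e ?zj ?ltn_addr //.
    exact: ltn_trans aj (ltn_trans jn _).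
  exists x, w, u => k km; rewrite !e ?ltn_addr // hx //; congr (_ + _ + _).
  by apply: eq_bigr => a _; rewrite e ?ltn_addr // (leqW (leqW _)).
rewrite /euclid_step (negbTE ne0) in hG'.
have iw : (i < m + n)%N by apply: ltn_addr.
have jn2 : (j < n.+2)%N by apply: ltn_trans jn _; apply: leqW.
have nn2 : (n < n.+2)%N by apply: leqW.
have nj : (n == j) = false by rewrite gtn_eqF.
have eJ k : (k < m + n)%N -> G' j k = ((G n k - (G n i %/ G j i)%Z * G j k) %% d)%Z.
  by move=> kw; rewrite hG' // eqxx.
have eN k : (k < m + n)%N -> G' n k = G j k by move=> kw; rewrite hG' // nj eqxx.
have eO a k : (a < n.+2)%N -> a != j -> a != n -> (k < m + n)%N -> G' a k = G a k.
  by move=> an /negbTE aj /negbTE ann kw; rewrite hG' // aj ann.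
have [qr _ _] := sG j jn2; have /andP[v0 vd] := qr i iw.
set q := (G n i %/ G j i)%Z in hG' eJ.
(* The remainder is below [G j i], which is at most [d], so reducing modulo [d] does not change it:
   in column [i] this is a division of integers. *)
have eJi : G' j i = (G n i %% G j i)%Z.
  rewrite eJ // /q -/(modz (G n i) (G j i)) modz_small // modz_ge0 //=.
  apply: lt_le_trans vd; rewrite ltz_pmod // lt_def ne0; exact: v0.
pose t k := ((G n k - q * G j k) %/ d)%Z.
have ik k : (k < i)%N -> (k < m + n)%N by move=> /ltn_trans; apply.
have zJ k : (k < i)%N -> G' j k = 0.
  by move=> ki; rewrite eJ ?ik // zp // z // mulr0 subr0 mod0z.
have eJk k : (k < m)%N ->
    G n k = G' j k + q * G' n k + (if (i < k)%N then d * t k else 0).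
  move=> km; have kw := ltn_addr n km.
  have [ki|] := ltnP i k; first by rewrite eJ // eN // modzE /t; ring.
  rewrite leq_eqVlt addr0 => /orP [/eqP ->|ki].
    by rewrite eJi eN // /q addrC -divz_eq.
  by rewrite zp // zJ // eN // z // mulr0 addr0.
split.
- move=> a k an ki; have [->|aj] := eqVneq a j; first exact: zJ.
  by rewrite eO ?z ?ik ?(leqW (leqW _)) // (ltn_eqF an).
- by move=> k ki; rewrite eN ?ik // z.
- by rewrite eN // lt_def ne0.
- move=> a aj; have an := ltn_trans aj jn.
  by rewrite eO ?zj ?(leqW (leqW _)) // ?(ltn_eqF aj) ?(ltn_eqF an).
(* Substituting the old pivot, which is the new generator plus [q] times the new pivot plus [d * t],
   gives these coefficients. *)
exists (fun a => if a == j then u else x a), (fun k => w k + u * t k), (x j + u * q).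
move=> k km; have kw := ltn_addr n km.
rewrite eO ?(gtn_eqF (ltnSn n)) ?(gtn_eqF (ltn_trans jn _)) // hx //.
rewrite (row_sum (fun a => x a * G a k) jn).
rewrite (row_sum (fun a => (if a == j then u else x a) * G' a k) jn) eqxx.
rewrite [X in _ = _ + X + _ + _](eq_bigr (fun a : 'I_n => x a * G a k)).
  by rewrite {1}(eJk k km) (eN k kw); case: ifP => _; ring.
move=> a aj; rewrite (negbTE aj) eO //; first exact: leqW (leqW (ltn_ord a)).
by rewrite (ltn_eqF (ltn_ord a)).
Qed.

(* While the entry of generator j is nonzero, its product with the pivot      *)
(* halves at each division but the first. *)
Definition progress i j t G :=
  G j i = 0 \/ (G n i * G j i * (2 ^ t)%N%:Z <= 2 * d ^+ 2 /\ ((0 < t)%N -> G j i < G n i)).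

(** If h = q v + r with r < v < h, then q is at least 1 and 2 r <= h, so the product v r is at most
    half of h v. At the first division v < h may fail; the factor 2 in the bound pays for it. *)
Lemma euclid_progress S i j t G G' : (i < m)%N -> (j < n)%N -> sound S G ->
  euclid_step i j G G' -> pivoting i j G -> progress i j t G -> progress i j t.+1 G'.
Proof.
move=> im jn sG hG' [_ _ p0 _ _] pr.
have iw : (i < m + n)%N by apply: ltn_addr.
have jn2 : (j < n.+2)%N by apply: ltn_trans jn _; apply: leqW.
have nn2 : (n < n.+2)%N by apply: leqW.
have nj : (n == j) = false by rewrite gtn_eqF.
have [e0|ne0] := eqVneq (G j i) 0; first by left; rewrite hG' // e0 eqxx.
case: pr => [e|[pr1 pr2]]; first by rewrite e eqxx in ne0.
rewrite /euclid_step (negbTE ne0) in hG'; right.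
have [qr _ _] := sG j jn2; have /andP[v0 vd] := qr i iw.
have v1 : 0 < G j i by rewrite lt_def ne0.
rewrite (hG' n i) // nj eqxx (hG' j i) // eqxx -/(modz (G n i) (G j i)).
have r0 := modz_ge0 (G n i) ne0; have r1 := ltz_pmod (G n i) v1.
rewrite modz_small; last by rewrite r0 (lt_le_trans r1 vd).
split=> //; have eh := divz_eq (G n i) (G j i).
move: (G j i) (G n i) (modz _ _) (divz _ _) p0 ne0 v0 vd v1 pr1 pr2 r0 r1 eh => v h r q.
move=> p0 ne0 v0 vd v1 pr1 pr2 r0 r1 eh.
case: t pr1 pr2 => [|t] pr1 pr2.
  rewrite expn1; have : v * r <= d * d by apply: ler_pM => //; apply: ltW (lt_le_trans r1 vd).
  by rewrite expr2; lia.
have hv := pr2 isT.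
have q1 : 1 <= q.
  by rewrite leNgt; apply/negP => q0; have : q * v <= 0; [apply: mulr_le0_ge0; lia|lia].
have r2 : r * 2 <= h by have : v <= q * v; [rewrite ler_peMl|lia].
apply: le_trans pr1; rewrite expnS PoszM mulrA ler_wpM2r //.
by rewrite [h * v]mulrC -mulrA ler_wpM2l.
Qed.

(** Were the entry still nonzero, its product with the pivot would be at least 1, contradicting the
    bound. *)
Lemma progress_end S i j t G : (i < m)%N -> (j < n)%N -> sound S G ->
  pivoting i j G -> progress i j t G ->
  2 * d ^+ 2 < (2 ^ t)%N%:Z -> pivoting i j.+1 G.
Proof.
move=> im jn sG [z zp p0 zj hx] pr h.
have iw : (i < m + n)%N by apply: ltn_addr.
have jn2 : (j < n.+2)%N by apply: ltn_trans jn _; apply: leqW.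
have [qr _ _] := sG j jn2; have /andP[v0 vd] := qr i iw.
have e : G j i = 0.
  case: pr => // [[pr _]]; apply/eqP; apply: contraT => ne.
  have v1 : 1 <= G j i by rewrite -gtz0_ge1 lt_def ne.
  have h1 : 1 <= G n i * G j i by rewrite -gtz0_ge1 mulr_gt0 // lt_def ne.
  have h2 : (2 ^ t)%N%:Z <= G n i * G j i * (2 ^ t)%N%:Z by rewrite ler_peMl.
  by have := lt_le_trans h (le_trans h2 pr); rewrite ltxx.
by split=> // a; rewrite ltnS leq_eqVlt => /orP [/eqP ->|/zj].
Qed.

Lemma progress0 S i j G : (i < m)%N -> (j < n)%N -> sound S G -> progress i j 0 G.
Proof.
move=> im jn sG; right; split=> //.
have iw : (i < m + n)%N by apply: ltn_addr.
have [|h1 _ _] := sG j; first by apply: ltn_trans jn _; apply: leqW.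
have [|h2 _ _] := sG n; first by apply: leqW.
have /andP[a1 a2] := h1 i iw; have /andP[b1 b2] := h2 i iw.
by rewrite expn0 mulr1 expr2; have := ler_pM b1 a1 b2 a2; have := mulr_ge0 b1 a1; lia.
Qed.

Definition reduce i (G G' : nat -> nat -> int) := forall a k,
  (a < n.+2)%N -> (k < m + n)%N ->
  G' a k = if a == n.+1 then ((G n.+1 k - (G n.+1 i %/ G n i)%Z * G n k) %% d)%Z
           else G a k.

(** When all generators vanish in column [i], the entry of the right-hand side is exactly [u] times
    that of the pivot, so the quotient recovers the unknown coefficient [u]. Soundness holds for any
    quotient. *)
Lemma reduce_ok S i G G' : (i < m)%N -> sound S G -> reduce i G G' ->
  sound S G' /\ (pivoting i n G -> spanned i.+1 G').
Proof.
move=> im sG hG'; have iw : (i < m + n)%N by apply: ltn_addr.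
have nn2 : (n < n.+2)%N by apply: leqW.
have [p1 p2 p3] := sG n nn2; have [q1 q2 q3] := sG n.+1 (ltnSn _).
have e k : (k < m + n)%N -> G' n.+1 k =
    ((G n.+1 k - (G n.+1 i %/ G n i)%Z * G n k) %% d)%Z.
  by move=> kw; rewrite hG' // eqxx.
have eO a k : (a < n.+2)%N -> a != n.+1 -> (k < m + n)%N -> G' a k = G a k.
  by move=> an ne kw; rewrite hG' // (negbTE ne).
split.
  move=> a an; have [h1 h2 h3] := sG a an.
  have [ea|ne] := eqVneq a n.+1; split.
  - by move=> k kw; rewrite ea e // modz_range.
  - by move=> l ln Sl; rewrite ea e ?ltn_add2l // p2 // q2 // mulr0 subr0 mod0z.
  - rewrite ea => k km; apply: (rel_comb (e := c) e) => // l lm.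
      by have := q3 l lm; rewrite eqxx.
    by have := p3 l lm; rewrite (ltn_eqF (ltnSn n)).
  - by move=> k kw; rewrite eO ?h1.
  - by move=> l ln Sl; rewrite eO ?ltn_add2l ?h2.
  move=> k km; rewrite eO ?ltn_addr //.
  have := h3 k km; rewrite (negbTE ne).
  rewrite (eq_bigr (fun j : 'I_n => C k j * G' a (m + j)%N)) // => j _.
  by rewrite eO ?ltn_add2l.
move=> [z zp p0 zn [x [w [u hx]]]].
have qu : (G n.+1 i %/ G n i)%Z = u.
  rewrite hx // ltnn addr0 big1 ?add0r ?mulzK ?gt_eqF // => a _.
  by rewrite zn ?mulr0.
have z' a k : (a < n)%N -> (k <= i)%N -> G' a k = 0.
  move=> an ki; rewrite eO ?(leqW (leqW _)) ?(leq_ltn_trans ki) //; last first.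
    by rewrite (ltn_eqF (leqW an)).
  by move: ki; rewrite leq_eqVlt => /orP [/eqP ->|]; [apply: zn|apply: z].
split; first by move=> a k an; rewrite ltnS; apply: z'.
exists x, (fun k => w k - ((G n.+1 k - u * G n k) %/ d)%Z) => k km.
have kw := ltn_addr n km.
have -> : \sum_(a < n) x a * G' a k = \sum_(a < n) x a * G a k.
  apply: eq_bigr => a _; rewrite eO //; first exact: leqW (leqW (ltn_ord a)).
  by rewrite (ltn_eqF (leqW (ltn_ord a))).
rewrite e // qu; case: ltnP => ki; first by rewrite modzE {1}hx // ki; ring.
rewrite hx // ltnNge ki /= addr0 addrK big1 ?addr0 ?mod0z // => a _.
by rewrite -(eO a) ?z' ?mulr0 ?(ltn_eqF (leqW (ltn_ord a))) // (leqW (leqW (ltn_ord a))).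
Qed.

(** The entries are nonnegative, so one test on their sum shows that all vanish. The last row then
    expresses [- c] modulo [d] by the columns of [C], whence the sign. *)
Lemma sound_solution S G : sound S G ->
  \sum_(k < m) G n.+1 k = 0 -> mod_solution S (fun j => - G n.+1 (m + j)%N).
Proof.
move=> sG G0; have [h1 h2 h3] := sG n.+1 (ltnSn _); split.
  by move=> j jn Sj; rewrite h2 ?oppr0.
move=> k km.
have Gk : G n.+1 k = 0.
  move/eqP: G0; rewrite psumr_eq0 => [/allP /(_ (Ordinal km))|l _].
    by rewrite mem_index_enum => /(_ isT) /eqP.
  by have /andP[] := h1 l (ltn_addr _ (ltn_ord l)).
have := h3 k km; rewrite eqxx Gk => /dvdzP [z e]; apply/dvdzP; exists (- z).
rewrite mulNr -e (eq_bigr (fun j : 'I_n => - (C k j * G n.+1 (m + j)%N))).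
  by rewrite sumrN; ring.
by move=> j _; rewrite mulrN.
Qed.

Lemma spanned_end G : spanned m G -> \sum_(k < m) G n.+1 k = 0.
Proof.
move=> [z [x [w h]]]; apply: big1 => k _; rewrite h // leqNgt ltn_ord addr0.
by apply: big1 => a _; rewrite z ?mulr0.
Qed.

End Solver.

(** * A structured array language and its compilation *)

Lemma bitlen_le (z : int) l : (`|z| <= 2 ^ l)%N -> (bitlen z <= l.+2)%N.
Proof. by move=> h; rewrite /bitlen !ltnS -(@trunc_expnK 2 l) // leq_trunc_log. Qed.

(** Evaluated on values of at most [L] bits, an expression yields at most [L * weight e] bits, as
    [eval_bound] shows; [unit_cost] is then its cost per unit of [L]. *)
Fixpoint weight (e : expr) : nat :=
  match e with
  | Cst z => `|z|%N
  | Get _ => 1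
  | Bin _ e1 e2 => (weight e1 + weight e2).+1
  end.

Fixpoint unit_cost (e : expr) : nat :=
  (weight e + 2 +
   match e with
   | Cst _ => 0
   | Get a => unit_cost a
   | Bin _ e1 e2 => unit_cost e1 + unit_cost e2
   end)%N.

Definition bounded (L : nat) (s : store) := forall a, (`|s a| <= 2 ^ L)%N.

Lemma eval_bound L s e : (0 < L)%N -> bounded L s ->
  (`|eval s e| <= 2 ^ (L * weight e))%N.
Proof.
move=> L0 bs; elim: e => [z|a _|o e1 IH1 e2 IH2] /=.
- apply: leq_trans (ltnW (ltn_expl _ (ltnSn 1))) _.
  by rewrite leq_exp2l // leq_pmull.
- by rewrite muln1.
have P k : (0 < 2 ^ (L * k))%N by rewrite expn_gt0.
have S2 : (2 ^ (L * weight e1) + 2 ^ (L * weight e2)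
             <= 2 ^ (L * (weight e1 + weight e2).+1))%N.
  have h1 := P (weight e1); have h2 := P (weight e2).
  rewrite mulnS expnD mulnDr expnD.
  have h3 : (2 <= 2 ^ L)%N by rewrite -{1}(expn1 2) leq_exp2l.
  apply: leq_trans (leq_mul h3 (leqnn _)).
  by move: h1 h2; set x := (2 ^ (L * weight e1))%N; set y := (2 ^ _)%N; nia.
have M2 : (2 ^ (L * weight e1) * 2 ^ (L * weight e2)
             <= 2 ^ (L * (weight e1 + weight e2).+1))%N.
  by rewrite -expnD leq_exp2l // -mulnDr leq_pmul2l.
case: o => /=.
- by apply: leq_trans S2; lia.
- by apply: leq_trans S2; lia.
- by apply: leq_trans M2; rewrite abszM leq_mul.
apply: leq_trans (lez_div _ _) _; apply: leq_trans IH1 _.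
by rewrite leq_exp2l // leq_pmul2l //; lia.
Qed.

Lemma cost_bound L s e : (0 < L)%N -> bounded L s ->
  (cost s e <= unit_cost e * L)%N.
Proof.
move=> L0 bs.
have B f : (bitlen (eval s f) <= (weight f + 2) * L)%N.
  apply: leq_trans (bitlen_le (eval_bound _ L0 bs)) _; nia.
elim: e => [z|a IHa|o e1 IH1 e2 IH2] /=.
- by have := B (Cst z); rewrite /= !addn0.
- by have := B (Get a) => /=; move: IHa; lia.
by have := B (Bin o e1 e2) => /=; move: IH1 IH2; lia.
Qed.

(* An injective pairing, computable with the operations of the machine. *)
Definition pair2 (a b : nat) : nat := ((a + b) ^ 2 + a)%N.

(** The value lies between the square of [a + b] and the next square, so it determines [a + b] and
    then [a]. *)
Lemma pair2_inj a b a' b' : pair2 a b = pair2 a' b' -> a = a' /\ b = b'.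
Proof.
rewrite /pair2 => h.
have e : (a + b = a' + b')%N by nia.
by move: h; rewrite e; lia.
Qed.

(* Two-dimensional arrays numbered by [r] are kept on disjoint sets of        *)
(* negative addresses, except for column 0 of array 0, which is the part of   *)
(* the store used for input and output.                                       *)
Definition cell (r i j : nat) : int :=
  if (r == 0%N) && (j == 0%N) then Posz i else Negz (pair2 r (pair2 i j)).

Arguments cell : simpl never.

Lemma cell_inj r i j r' i' j' :
  cell r i j = cell r' i' j' -> [/\ r = r', i = i' & j = j'].
Proof.
rewrite /cell; case: andP => [[/eqP -> /eqP ->]|_]; case: andP => [[/eqP -> /eqP ->]|_] //.
  by case=> ->.
by case=> /pair2_inj [-> /pair2_inj [-> ->]].
Qed.

Definition epair (a b : expr) : expr :=
  Bin Add (Bin Mul (Bin Add a b) (Bin Add a b)) a.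

(** For natural [b] the quotient of 1 by [1 + b] is 1 if [b] is zero and 0 otherwise; it selects
    between the two kinds of addresses of array 0 without a test. *)
Definition ecell (r : nat) (a b : expr) : expr :=
  let e := Bin Defs.Sub (Cst (- 1)) (epair (Cst r%:Z) (epair a b)) in
  if r is 0 then
    Bin Add e (Bin Mul (Bin Div (Cst 1) (Bin Add (Cst 1) b)) (Bin Defs.Sub a e))
  else e.

Lemma div1z (k : nat) : (1 %/ (1 + k%:Z))%Z = (k == 0%N)%:R.
Proof.
case: k => [|k]; first by rewrite addr0 divzz.
by rewrite divz_small //; lia.
Qed.

Lemma eval_ecell s r a b (i j : nat) : eval s a = i%:Z -> eval s b = j%:Z ->
  eval s (ecell r a b) = cell r i j.
Proof.
move=> ha hb.
have e : eval s (Bin Defs.Sub (Cst (- 1)) (epair (Cst r%:Z) (epair a b)))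
         = Negz (pair2 r (pair2 i j)).
  rewrite /= ha hb /pair2 NegzE; lia.
rewrite /cell /ecell; case: r e => [|r] e //.
set f := Bin Defs.Sub _ _ in e *.
transitivity (eval s f + (1 %/ (1 + eval s b))%Z * (eval s a - eval s f)) => //.
rewrite e ha hb div1z; case: j {e hb f} => [|j] /=; lia.
Qed.

(** * The array language and its weakest preconditions *)

Inductive ix := IV of nat | IC of nat | IA of ix & ix | IM of ix & ix.

Inductive ex :=
  | EC of int
  | EI of ix
  | ER of nat & ix & ix
  | EB of binop & ex & ex
  | EZ of ex & ex & ex.

(* A structured language without data-dependent control. Loop variables are   *)
(* de Bruijn levels, and the length of a loop is the value of a variable.     *)
(* [Fill r a b e] overwrites simultaneously the first entries of the array r, *)
(* [LetBits e p] binds an upper bound on the binary length of e.              *)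
Inductive prog :=
  | Fill of nat & nat & nat & ex
  | Sq of prog & prog
  | For of nat & prog
  | LetBits of ex & prog.

Definition arrays := nat -> nat -> nat -> int.

Fixpoint ival (env : seq nat) (i : ix) : nat :=
  match i with
  | IV k => nth 0 env k
  | IC c => c
  | IA i1 i2 => (ival env i1 + ival env i2)%N
  | IM i1 i2 => (ival env i1 * ival env i2)%N
  end.

Fixpoint ev (env : seq nat) (g : arrays) (e : ex) : int :=
  match e with
  | EC z => z
  | EI i => (ival env i)%:Z
  | ER r i j => g r (ival env i) (ival env j)
  | EB o e1 e2 => eval_op o (ev env g e1) (ev env g e2)
  | EZ e1 e2 e3 => if ev env g e1 == 0 then ev env g e2 else ev env g e3
  end.

Definition fill r a b (f : nat -> nat -> int) (g : arrays) : arrays :=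
  fun r' i j => if [&& r' == r, (i < a)%N & (j < b)%N] then f i j else g r' i j.

(* Besides ensuring Q, [wp L] keeps all absolute values below 2 ^ L, which    *)
(* bounds the cost of every instruction. *)
Fixpoint wp (L : nat) (p : prog) (env : seq nat) (Q : arrays -> Prop)
    (g : arrays) : Prop :=
  match p with
  | Fill r a b e =>
      (forall i j, (i < nth 0 env a)%N -> (j < nth 0 env b)%N ->
         (`|ev (env ++ [:: i; j]) g e| <= 2 ^ L)%N) /\
      Q (fill r (nth 0%N env a) (nth 0%N env b)
           (fun i j => ev (env ++ [:: i; j]) g e) g)
  | Sq p q => wp L p env (wp L q env Q) g
  | For a p =>
      exists I : nat -> arrays -> Prop,
        [/\ I 0%N g,
            forall k g, (k < nth 0 env a)%N -> I k g ->
              wp L p (rcons env k) (I k.+1) g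
          & forall g, I (nth 0%N env a) g -> Q g]
  | LetBits e p =>
      (`|ev env g e| <= 2 ^ L)%N /\
      forall k, ev env g e < (2 ^ k)%N -> (k <= L.+1)%N ->
        wp L p (rcons env k) Q g
  end.

(** * Compilation and time bounds *)

Definition var (k : nat) : expr := Cst (cell 1 k 0).

(* Arrays 1 and 2 of the machine are reserved for variables and temporaries. *)
Definition reg (r : nat) : nat := if r is r'.+1 then r'.+3 else 0.

Fixpoint cix (d : nat) (i : ix) : expr :=
  match i with
  | IV k => if (k < d)%N then Get (var k) else Cst 0
  | IC c => Cst c%:Z
  | IA i1 i2 => Bin Add (cix d i1) (cix d i2)
  | IM i1 i2 => Bin Mul (cix d i1) (cix d i2)
  end.

(** [EZ] becomes arithmetic: the quotient of 1 by 1 plus the square of [e1] is 1 exactly when [e1]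
    is zero. Both branches are evaluated. *)
Fixpoint cex (d : nat) (e : ex) : expr :=
  match e with
  | EC z => Cst z
  | EI i => cix d i
  | ER r i j => Get (ecell (reg r) (cix d i) (cix d j))
  | EB o e1 e2 => Bin o (cex d e1) (cex d e2)
  | EZ e1 e2 e3 =>
      Bin Add (Bin Mul (Bin Div (Cst 1)
                          (Bin Add (Cst 1) (Bin Mul (cex d e1) (cex d e1))))
                 (Bin Defs.Sub (cex d e2) (cex d e3))) (cex d e3)
  end.

Definition cfor (d : nat) (c : expr) (body : cmd) : cmd :=
  Seq (Assign (var d) (Cst 0))
    (While (Bin Defs.Sub c (Get (var d)))
       (Seq body (Assign (var d) (Bin Add (Get (var d)) (Cst 1))))).

Definition cfill (d : nat) (ca cb : expr) (r : nat) (e : expr) : cmd :=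
  cfor d ca (cfor d.+1 cb (Assign (ecell r (Get (var d)) (Get (var d.+1))) e)).

(** After k rounds the value a has become the floor of a / 2^k, so the count at the end is some k
    with a < 2^k. *)
Definition halve (d : nat) : cmd :=
  let x := Cst (cell 2 0 0) in
  While (Get x) (Seq (Assign x (Bin Div (Get x) (Cst 2)))
                   (Assign (var d) (Bin Add (Get (var d)) (Cst 1)))).

(** [Fill] first writes to the temporary array 2 and then copies, because its expression may read
    the entries being overwritten. *)
Fixpoint compile (d : nat) (p : prog) : cmd :=
  match p with
  | Fill r a b e =>
      Seq (cfill d (cix d (IV a)) (cix d (IV b)) 2 (cex d.+2 e))
        (cfill d (cix d (IV a)) (cix d (IV b)) (reg r)
           (Get (ecell 2 (Get (var d)) (Get (var d.+1)))))
  | Sq p q => Seq (compile d p) (compile d q)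
  | For a p => cfor d (cix d (IV a)) (compile d.+1 p)
  | LetBits e p =>
      Seq (Assign (Cst (cell 2 0 0)) (cex d e))
        (Seq (Assign (var d) (Cst 0)) (Seq (halve d) (compile d.+1 p)))
  end.

Definition tassign (a e : expr) (L : nat) : nat :=
  ((unit_cost a + unit_cost e) * L)%N.

(** The length of a loop is the value of a variable, and these are kept at most [2 * L]; so the
    bound is a function of [L] alone. *)
Definition tfor (d : nat) (c : expr) (T : nat -> nat) (L : nat) : nat :=
  (tassign (var d) (Cst 0) L +
   (2 * L * (unit_cost (Bin Defs.Sub c (Get (var d))) * L +
      (T L + tassign (var d) (Bin Add (Get (var d)) (Cst 1)) L)) +
    unit_cost (Bin Defs.Sub c (Get (var d))) * L))%N.

Definition tfill (d : nat) (ca cb : expr) (r : nat) (e : expr) : nat -> nat :=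
  tfor d ca (tfor d.+1 cb (tassign (ecell r (Get (var d)) (Get (var d.+1))) e)).

Definition thalve (d : nat) (L : nat) : nat :=
  let x := Cst (cell 2 0 0) in
  (2 * L * (unit_cost (Get x) * L + (tassign x (Bin Div (Get x) (Cst 2)) L +
     tassign (var d) (Bin Add (Get (var d)) (Cst 1)) L)) + unit_cost (Get x) * L)%N.

Fixpoint time (d : nat) (p : prog) (L : nat) : nat :=
  match p with
  | Fill r a b e =>
      (tfill d (cix d (IV a)) (cix d (IV b)) 2 (cex d.+2 e) L +
       tfill d (cix d (IV a)) (cix d (IV b)) (reg r)
           (Get (ecell 2 (Get (var d)) (Get (var d.+1)))) L)%N
  | Sq p q => (time d p L + time d q L)%N
  | For a p => tfor d (cix d (IV a)) (time d.+1 p) L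
  | LetBits e p =>
      (tassign (Cst (cell 2 0 0)) (cex d e) L +
        (tassign (var d) (Cst 0) L + (thalve d L + time d.+1 p L)))%N
  end.

Definition poly_bounded (f : nat -> nat) :=
  exists p : {poly nat}, forall x, (f x <= p.[x])%N.

Lemma poly_bounded_cst c : poly_bounded (fun=> c).
Proof. by exists c%:P => x; rewrite hornerC. Qed.

Lemma poly_bounded_id : poly_bounded id.
Proof. by exists 'X => x; rewrite hornerX. Qed.

Lemma poly_boundedD f g : poly_bounded f -> poly_bounded g ->
  poly_bounded (fun x => f x + g x)%N.
Proof. by move=> [p hp] [q hq]; exists (p + q) => x; rewrite hornerD leq_add. Qed.

Lemma poly_boundedM f g : poly_bounded f -> poly_bounded g ->
  poly_bounded (fun x => f x * g x)%N.
Proof. by move=> [p hp] [q hq]; exists (p * q) => x; rewrite hornerM leq_mul. Qed.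

Lemma horner_nat_homo (p : {poly nat}) x y : (x <= y)%N -> (p.[x] <= p.[y])%N.
Proof.
move=> xy; elim/poly_ind: p => [|p c IH]; first by rewrite !horner0.
by rewrite !hornerMXaddC leq_add2r leq_mul.
Qed.

Lemma poly_bounded_time d p : poly_bounded (time d p).
Proof.
have C := poly_bounded_cst; have X := poly_bounded_id.
have D := poly_boundedD; have M := poly_boundedM.
have A a e : poly_bounded (tassign a e) by apply: M.
have F k c T : poly_bounded T -> poly_bounded (tfor k c T).
  move=> hT; apply: (D); first exact: A.
  apply: (D); last exact: M.
  apply: (M); first exact: M.
  apply: (D); first exact: M.
  by apply: D.
elim: p d => [r a b e|p IHp q IHq|a p IHp|e p IHp] d /=.
- by apply: D; apply: (F); apply: (F).
- exact: D.
- exact: F.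
apply: (D) => //; apply: (D) => //; apply: (D) => //.
apply: (D); last exact: M.
apply: (M); first exact: M.
apply: (D); first exact: M.
exact: D.
Qed.

(** * Correctness of the compilation *)

Definition runs (c : cmd) (s : store) (T : nat) (Q : store -> Prop) :=
  exists t s', [/\ exec c s t s', (t <= T)%N & Q s'].

Lemma runs_seq c1 c2 s T1 T2 (Q R : store -> Prop) : runs c1 s T1 R ->
  (forall s', R s' -> runs c2 s' T2 Q) -> runs (Seq c1 c2) s (T1 + T2) Q.
Proof.
move=> [t1 [s1 [e1 l1 r1]]] /(_ _ r1) [t2 [s2 [e2 l2 q]]].
exists (t1 + t2)%N, s2; split=> //; [exact: exec_seq e1 e2|exact: leq_add].
Qed.

Lemma runs_impl c s T (Q R : store -> Prop) : runs c s T Q ->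
  (forall s', Q s' -> R s') -> runs c s T R.
Proof. by move=> [t [s1 [e l q]]] h; exists t, s1; split=> //; apply: h. Qed.

Lemma runs_assign L a e s (Q : store -> Prop) : (0 < L)%N -> bounded L s ->
  Q [eta s with eval s a |-> eval s e] ->
  runs (Assign a e) s (tassign a e L) Q.
Proof.
move=> L0 bs q; exists (cost s a + cost s e)%N, [eta s with eval s a |-> eval s e].
split=> //; first exact: exec_assign.
by rewrite /tassign mulnDl leq_add ?cost_bound.
Qed.

Lemma runs_while L e body (I : nat -> store -> Prop) n T : (0 < L)%N ->
  (forall k s, I k s -> bounded L s) ->
  (forall k s, (k < n)%N -> I k s -> 0 < eval s e /\ runs body s T (I k.+1)) ->
  (forall s, I n s -> eval s e <= 0) ->
  forall s, I 0%N s ->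
    runs (While e body) s (n * (unit_cost e * L + T) + unit_cost e * L) (I n).
Proof.
move=> L0 bs Ibody Iend.
suff H j k s : (k + j = n)%N -> I k s ->
    runs (While e body) s (j * (unit_cost e * L + T) + unit_cost e * L) (I n).
  by move=> s; apply: H.
elim: j k s => [|j IH] k s; rewrite ?addn0 ?addnS => kn Ik.
  subst k; exists (cost s e), s; split=> //.
    by apply: exec_while_false; rewrite -leNgt; apply: Iend.
  by rewrite mul0n add0n cost_bound //; apply: bs Ik.
have [|e0 [t1 [s1 [x1 l1 I1]]]] := Ibody k s _ Ik; first by rewrite -kn ltnS leq_addr.
have [|t2 [s2 [x2 l2 I2]]] := IH k.+1 s1 _ I1; first by rewrite addSn.
exists (cost s e + t1 + t2)%N, s2; split=> //; first exact: exec_while_true x1 x2.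
by have := cost_bound e L0 (bs _ _ Ik); rewrite mulSn; lia.
Qed.

Definition repv (env : seq nat) (s : store) :=
  forall k, (k < size env)%N -> s (cell 1 k 0) = (nth 0%N env k)%:Z.

Definition repm (g : arrays) (s : store) :=
  forall r i j, s (cell (reg r) i j) = g r i j.

Lemma reg_inj : injective reg.
Proof. by case=> [|r] [|r'] //= [->]. Qed.

Lemma reg_neq1 r : reg r != 1%N. Proof. by case: r. Qed.

Lemma reg_neq2 r : reg r != 2%N. Proof. by case: r. Qed.

Lemma cell_neq r i j r' i' j' : r != r' -> (cell r i j == cell r' i' j') = false.
Proof. by move=> h; apply: contraNF h => /eqP /cell_inj [->]. Qed.

Lemma var_eq k l : (cell 1 k 0 == cell 1 l 0) = (k == l).
Proof. by apply/eqP/eqP => [/cell_inj []|->]. Qed.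

Lemma eval_cix env s i : repv env s -> eval s (cix (size env) i) = (ival env i)%:Z.
Proof.
move=> h; elim: i => [k|c|i hi j hj|i hi j hj] //=; rewrite ?hi ?hj //.
by case: ltnP => k1; [apply: h|rewrite nth_default].
Qed.

Lemma eval_cex env g s e : repv env s -> repm g s ->
  eval s (cex (size env) e) = ev env g e.
Proof.
move=> hv hm; elim: e => [z|i|r i j|o e1 h1 e2 h2|e1 h1 e2 h2 e3 h3].
- by [].
- exact: eval_cix.
- rewrite /= (@eval_ecell _ _ _ _ (ival env i) (ival env j)) //; exact: eval_cix.
- by rewrite /= h1 h2.
rewrite /= h1 h2 h3; set z := ev _ _ e1.
have -> : 1 + z * z = 1 + (`|z| * `|z|)%N%:Z by rewrite PoszM abszE -normrM ger0_norm // sqr_ge0.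
rewrite div1z muln_eq0 orbb absz_eq0.
by case: eqP => _; rewrite /= ?mulr1n ?mulr0n ?mul1r ?mul0r ?subrK ?add0r.
Qed.

Lemma boundedU L s a (v : int) : bounded L s -> (`|v| <= 2 ^ L)%N ->
  bounded L [eta s with a |-> v].
Proof. by move=> bs bv b /=; case: eqP. Qed.

Lemma leq_var L (v : nat) : (v <= 2 * L)%N -> (`|v%:Z| <= 2 ^ L)%N.
Proof.
rewrite absz_nat => h; apply: leq_trans h _.
case: L => // L; rewrite expnS leq_mul //; exact: ltn_expl.
Qed.

Lemma repvU env s r i j v : r != 1%N -> repv env s ->
  repv env [eta s with cell r i j |-> v].
Proof. by move=> r1 h k hk /=; rewrite cell_neq 1?eq_sym // h. Qed.

Lemma repvV env s d v : (size env <= d)%N -> repv env s ->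
  repv env [eta s with cell 1 d 0 |-> v].
Proof.
move=> sd h k hk /=; rewrite var_eq ifF ?h //.
by apply/negbTE; rewrite neq_ltn (leq_trans hk sd).
Qed.

Lemma repmV g s r i j v : (r == 1%N) || (r == 2%N) -> repm g s ->
  repm g [eta s with cell r i j |-> v].
Proof.
move=> r12 h r' i' j' /=; rewrite cell_neq ?h //.
by case/orP: r12 => /eqP ->; [exact: reg_neq1|exact: reg_neq2].
Qed.

Lemma repv_rcons env s k : repv env s -> s (cell 1 (size env) 0) = k%:Z ->
  repv (rcons env k) s.
Proof.
move=> h hk i; rewrite size_rcons ltnS leq_eqVlt nth_rcons.
case/orP=> [/eqP ->|hi]; first by rewrite ltnn eqxx hk.
by rewrite hi h.
Qed.

Lemma repv_belast env s k : repv (rcons env k) s ->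
  repv env s /\ s (cell 1 (size env) 0) = k%:Z.
Proof.
move=> h; split=> [i hi|].
  by have := h i; rewrite size_rcons nth_rcons hi => -> //; apply: ltnW.
by have := h (size env); rewrite size_rcons nth_rcons ltnn eqxx => ->.
Qed.

(** The invariant has to survive assignments to the loop variable, which is initialised and
    incremented outside the body. *)
Lemma runs_for L d c body n (J : nat -> store -> Prop) (T : nat -> nat) s :
  (0 < L)%N -> (n <= 2 * L)%N ->
  (forall k s, J k s -> bounded L s /\ eval s c = n%:Z) ->
  (forall k s v, J k s -> (v <= 2 * L)%N -> J k [eta s with cell 1 d 0 |-> v%:Z]) ->
  (forall k s, (k < n)%N -> J k s -> s (cell 1 d 0) = k%:Z ->
     runs body s (T L) (fun s' => J k.+1 s' /\ s' (cell 1 d 0) = k%:Z)) ->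
  J 0%N s -> runs (cfor d c body) s (tfor d c T L) (J n).
Proof.
move=> L0 nL hJ hV hB J0.
pose I k s := J k s /\ s (cell 1 d 0) = k%:Z.
apply: (@runs_seq _ _ _ _ _ _ (I 0%N)).
  apply: runs_assign => //; first by case: (hJ _ _ J0).
  by split; [apply: (hV _ _ 0%N)|rewrite /= eqxx].
move=> s1 I1.
pose T' := (T L + tassign (var d) (Bin Add (Get (var d)) (Cst 1)) L)%N.
have := @runs_while L (Bin Defs.Sub c (Get (var d)))
  (Seq body (Assign (var d) (Bin Add (Get (var d)) (Cst 1)))) I n T' L0.
case/(_ _ _ _ _ I1).
- by move=> k s2 [/hJ []].
- move=> k s2 kn [Jk vk]; split.
    by rewrite /= vk; case: (hJ _ _ Jk) => _ ->; rewrite subr_gt0 ltz_nat.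
  apply: runs_seq; first exact: hB kn Jk vk.
  move=> s3 [J3 v3]; apply: runs_assign => //; first by case: (hJ _ _ J3).
  rewrite /= v3 -PoszD addn1; split; last by rewrite /= ?eqxx.
  by apply: hV => //; apply: leq_trans nL.
- by move=> s2 [Jn vn] /=; rewrite vn; case: (hJ _ _ Jn) => _ ->; rewrite subrr.
move=> t [s' [x l [Jn _]]]; exists t, s'; split=> //.
apply: leq_trans l _; rewrite leq_add2r leq_mul2r.
by rewrite nL orbT.
Qed.

Lemma runs_fill L d ca cb na nb r e (f : nat -> nat -> int) (J : store -> Prop) s :
  (0 < L)%N -> (na <= 2 * L)%N -> (nb <= 2 * L)%N -> r != 1%N ->
  (forall i j, (i < na)%N -> (j < nb)%N -> (`|f i j| <= 2 ^ L)%N) ->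
  (forall s, J s -> [/\ bounded L s, eval s ca = na%:Z & eval s cb = nb%:Z]) ->
  (forall s v, J s -> (v <= 2 * L)%N -> J [eta s with cell 1 d 0 |-> v%:Z] /\
     J [eta s with cell 1 d.+1 0 |-> v%:Z]) ->
  (forall s i j, J s -> (i < na)%N -> (j < nb)%N ->
     J [eta s with cell r i j |-> f i j]) ->
  (forall s i j, J s -> (i < na)%N -> (j < nb)%N ->
     s (cell 1 d 0) = i%:Z -> s (cell 1 d.+1 0) = j%:Z -> eval s e = f i j) ->
  J s -> runs (cfill d ca cb r e) s (tfill d ca cb r e L)
    (fun s => J s /\ forall i j, (i < na)%N -> (j < nb)%N ->
                       s (cell r i j) = f i j).
Proof.
move=> L0 naL nbL r1 fb hJ hV hS hE Js.
pose I k (s : store) := J s /\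
  forall i j, (i < k)%N -> (j < nb)%N -> s (cell r i j) = f i j.
apply: (@runs_for _ _ _ _ _ I) => //.
- by move=> k s1 [/hJ []].
- move=> k s1 v [J1 h] vL; split; first by case: (hV _ _ J1 vL).
  by move=> i j hi hj; rewrite /= cell_neq // h.
move=> k {Js}s1 kn [J1 h1] v1.
pose I' l (s : store) := [/\ I k s, s (cell 1 d 0) = k%:Z &
   forall j, (j < l)%N -> s (cell r k j) = f k j].
suff [t [s' [x l [[J2 h2] v2 f2]]]] : runs (cfor d.+1 cb
    (Assign (ecell r (Get (var d)) (Get (var d.+1))) e)) s1
    (tfor d.+1 cb (tassign (ecell r (Get (var d)) (Get (var d.+1))) e) L) (I' nb).
  exists t, s'; split=> //; split=> //; split=> // i j.
  by rewrite ltnS leq_eqVlt => /orP [/eqP ->|] hj; [apply: f2|apply: h2].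
apply: (@runs_for _ _ _ _ _ I') => //.
- by move=> l s2 [[/hJ []]].
- move=> l s2 v [[J2 h2] v2 f2] vL; split.
  + split; first by case: (hV _ _ J2 vL).
    by move=> i j hi hj; rewrite /= cell_neq // h2.
  + by rewrite /= var_eq ltn_eqF.
  by move=> j hj; rewrite /= cell_neq // f2.
move=> l s2 ln [[J2 h2] v2 f2] vl.
apply: runs_assign => //; first by case: (hJ _ J2).
have -> : eval s2 (ecell r (Get (var d)) (Get (var d.+1))) = cell r k l.
  by apply: eval_ecell.
rewrite (hE s2 k l) //; split; last by rewrite /= cell_neq 1?eq_sym.
split=> //.
- split; first exact: hS.
  move=> i j hi hj /=; rewrite ifF ?h2 //.
  by apply/negP => /eqP /cell_inj [_ ei _]; rewrite ei ltnn in hi.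
- by rewrite /= cell_neq // eq_sym.
move=> j; rewrite ltnS leq_eqVlt /= => /orP [/eqP ->|hj]; first by rewrite eqxx.
rewrite ifF ?f2 //.
by apply/negP => /eqP /cell_inj [_ _ ej]; rewrite ej ltnn in hj.
Qed.

Lemma runs_halve L d s (a : int) (J : store -> Prop) :
  (0 < L)%N -> (`|a| <= 2 ^ L)%N ->
  (forall s, J s -> bounded L s) ->
  (forall s v, J s -> (v <= 2 * L)%N -> J [eta s with cell 1 d 0 |-> v%:Z]) ->
  (forall s v, J s -> (`|v| <= 2 ^ L)%N -> J [eta s with cell 2 0 0 |-> v]) ->
  J s -> s (cell 2 0 0) = a -> s (cell 1 d 0) = 0 ->
  runs (halve d) s (thalve d L)
    (fun s => J s /\ exists k : nat, [/\ s (cell 1 d 0) = k%:Z, a < (2 ^ k)%N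
                                 & (k <= L.+1)%N]).
Proof.
move=> L0 aL Jb JV JT Js sa sd.
have [n [nL a2 an]] : exists n, [/\ (n <= L.+1)%N, a < (2 ^ n)%N
    & forall k, (k < n)%N -> (2 ^ k)%N%:Z <= a].
  case: (lerP a 0) => a0.
    by exists 0%N; split=> //; rewrite expn0; apply: le_lt_trans a0 _.
  exists (trunc_log 2 `|a|).+1; split.
  - by rewrite ltnS -(@trunc_expnK 2 L) // leq_trunc_log.
  - by have := @trunc_log_ltn 2 `|a| isT; lia.
  move=> k; rewrite ltnS => kl.
  have h : (2 ^ trunc_log 2 `|a| <= `|a|)%N by apply: trunc_logP => //; lia.
  have : (2 ^ k <= 2 ^ trunc_log 2 `|a|)%N by rewrite leq_exp2l.
  lia.
pose I k (s : store) := [/\ J s, s (cell 1 d 0) = k%:Z &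
   s (cell 2 0 0) = (a %/ (2 ^ k)%N)%Z].
pose T := (tassign (Cst (cell 2 0 0)) (Bin Div (Get (Cst (cell 2 0 0))) (Cst 2)) L +
           tassign (var d) (Bin Add (Get (var d)) (Cst 1)) L)%N.
have := @runs_while L (Get (Cst (cell 2 0 0)))
  (Seq (Assign (Cst (cell 2 0 0)) (Bin Div (Get (Cst (cell 2 0 0))) (Cst 2)))
     (Assign (var d) (Bin Add (Get (var d)) (Cst 1)))) I n T L0.
case/(_ _ _ _ s _).
- by move=> k s1 [/Jb].
- move=> k s1 kn [J1 v1 x1]; split.
    by rewrite /= x1 gtz0_ge1 lez_divRL ?mul1r ?an // ltz_nat expn_gt0.
  have D : (`|(s1 (cell 2 0 0) %/ 2)%Z| <= 2 ^ L)%N.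
    by apply: leq_trans (lez_div _ _) _; apply: Jb.
  pose R (s : store) := [/\ J s, s (cell 1 d 0) = k%:Z &
    s (cell 2 0 0) = (a %/ (2 ^ k.+1)%N)%Z].
  apply: (@runs_seq _ _ _ _ _ _ R).
    apply: runs_assign => //; first exact: Jb.
    split; [exact: JT| by rewrite /= cell_neq |].
    by rewrite /= ?eqxx x1 expnSr PoszM divzMA_ge0.
  move=> s2 [J2 v2 x2]; apply: runs_assign => //; first exact: Jb.
  rewrite /= v2 -PoszD addn1; split; last by rewrite /= cell_neq.
    by apply: JV => //; lia.
  by rewrite /= ?eqxx.
- move=> s1 [J1 v1 x1]; rewrite /= x1 -ltzD1 add0r.
  by rewrite ltz_divLR ?mul1r // ltz_nat expn_gt0.
- by split=> //; rewrite expn0 divz1.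
move=> t [s' [x l [J1 v1 x1]]]; exists t, s'; split=> //; last by split=> //; exists n.
apply: leq_trans l _; rewrite leq_add2r leq_mul2r; apply/orP; right; lia.
Qed.

Lemma compile_correct L p env Q g s : (0 < L)%N ->
  all (leq^~ (2 * L)%N) env -> repv env s -> repm g s -> bounded L s ->
  wp L p env Q g ->
  runs (compile (size env) p) s (time (size env) p L)
    (fun s' => [/\ repv env s', bounded L s'
                 & exists2 g', repm g' s' & Q g']).
Proof.
move=> L0; elim: p env Q g s => [r a b e|p IHp q IHq|a p IHp|e p IHp] env Q g s;
  move=> envL hv hm bs.
- move=> [fb q].
  have nL k : (nth 0 env k <= 2 * L)%N.
    by have [h|h] := ltnP k (size env); [apply: (all_nthP 0%N envL)|rewrite nth_default].
  set f := fun i j => ev (env ++ [:: i; j]) g e in fb q.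
  set na := nth 0%N env a in fb q; set nb := nth 0%N env b in fb q.
  have ecount k s1 : repv env s1 -> eval s1 (cix (size env) (IV k)) = (nth 0%N env k)%:Z.
    exact: (@eval_cix _ _ (IV k)).
  pose J1 (s : store) := [/\ repv env s, repm g s & bounded L s].
  (* First pass: the arrays [g] stay represented while array 2 receives the new entries. *)
  apply: (@runs_seq _ _ _ _ _ _
    (fun s => J1 s /\ forall i j, (i < na)%N -> (j < nb)%N -> s (cell 2 i j) = f i j)).
    apply: (runs_fill (L := L)) => //; try exact: nL.
    + by move=> s1 [v1 m1 b1]; split=> //; apply: ecount.
    + move=> s1 v [v1 m1 b1] vL; split; split; try exact: repvV; try exact: repmV;
        by apply: boundedU => //; apply: leq_var.
    + move=> s1 i j [v1 m1 b1] hi hj; split; first exact: repvU.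
        exact: repmV.
      by apply: boundedU => //; apply: fb.
    move=> s1 i j [v1 m1 b1] hi hj vi vj.
    rewrite /f -(eval_cex e (s := s1)) //; first by rewrite size_cat addn2.
    rewrite (_ : env ++ [:: i; j] = rcons (rcons env i) j); last by rewrite -!cats1 -catA.
    by apply: repv_rcons; [apply: repv_rcons|rewrite size_rcons].
  move=> {hv hm bs}s {J1} [[hv hm bs] hf].
  pose g' := fill r na nb f g.
  (* Second pass: only entries outside the overwritten block are still known to agree with [g]. *)
  pose J2 (s : store) := [/\ repv env s, bounded L s,
    forall i j, (i < na)%N -> (j < nb)%N -> s (cell 2 i j) = f i j &
    forall r' i j, ~~ [&& r' == r, (i < na)%N & (j < nb)%N] ->
      s (cell (reg r') i j) = g r' i j].
  apply: (@runs_impl _ _ _ (fun s => J2 s /\ forall i j, (i < na)%N -> (j < nb)%N ->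
                     s (cell (reg r) i j) = f i j)); last first.
  + move=> s1 [[v1 b1 _ m1] f1]; split=> //; exists g' => //.
    move=> r' i j; rewrite /g' /fill.
    by case: ifPn => [/and3P [/eqP -> hi hj]|]; [apply: f1|apply: m1].
  + apply: (runs_fill (L := L)) => //; try exact: nL; first exact: reg_neq1.
    * by move=> s1 [v1 b1 _ _]; split=> //; apply: ecount.
    * move=> s1 v [v1 b1 t1 m1] vL; split; split; try exact: repvV;
      try (by apply: boundedU => //; apply: leq_var);
      try (by move=> i j hi hj /=; rewrite cell_neq // t1);
      by move=> r' i j h /=; rewrite cell_neq ?reg_neq1 // m1.
    * move=> s1 i j [v1 b1 t1 m1] hi hj; split.
      - by apply: repvU => //; apply: reg_neq1.
      - by apply: boundedU => //; apply: fb.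
      - by move=> i' j' hi' hj' /=; rewrite cell_neq 1?eq_sym ?reg_neq2 // t1.
      move=> r' i' j' h /=; rewrite ifF ?m1 //.
      apply/negP => /eqP /cell_inj [/reg_inj er ei ej].
      by move: h; rewrite er ei ej eqxx hi hj.
    * move=> s1 i j [v1 b1 t1 m1] hi hj vi vj.
      have h : eval s1 (ecell 2 (Get (var (size env))) (Get (var (size env).+1))) = cell 2 i j.
        exact: eval_ecell.
      by rewrite -(t1 i j) // -h.
- move=> /= w; apply: runs_seq; first exact: IHp w.
  by move=> s1 [v1 b1 [g1 m1 w1]]; apply: IHq w1.
- move=> [I [I0 IS IE]] /=.
  have nL k : (nth 0 env k <= 2 * L)%N.
    by have [h|h] := ltnP k (size env); [apply: (all_nthP 0%N envL)|rewrite nth_default].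
  pose J k (s : store) := [/\ repv env s, bounded L s & exists2 g', repm g' s & I k g'].
  apply: (@runs_impl _ _ _ (J (nth 0%N env a))); last first.
  + by move=> s1 [v1 b1 [g1 m1 i1]]; split=> //; exists g1 => //; apply: IE.
  + apply: (runs_for (L := L)) => //; try exact: nL.
    * by move=> k s1 [v1 b1 _]; split=> //; apply: (@eval_cix _ _ (IV a)).
    * move=> k s1 v [v1 b1 [g1 m1 i1]] vL; split; first exact: repvV.
        by apply: boundedU => //; apply: leq_var.
      by exists g1 => //; apply: repmV.
    * move=> k s1 kn [v1 b1 [g1 m1 i1]] vk.
      have [||t [s' [x l [v2 b2 h2]]]] := IHp (rcons env k) _ _ s1 _ _ m1 b1 (IS _ _ kn i1).
      - by rewrite all_rcons envL andbT (leq_trans (ltnW kn)).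
      - exact: repv_rcons.
      rewrite size_rcons in x l; exists t, s'; split=> //.
      by have [] := repv_belast v2.
    by split=> //; exists g.
move=> [be w] /=.
pose J (s : store) := [/\ repv env s, bounded L s & repm g s].
pose J1 s := J s /\ s (cell 2 0 0) = ev env g e.
apply: (@runs_seq _ _ _ _ _ _ J1).
  apply: runs_assign => //; rewrite /= (eval_cex _ hv hm); split; last by rewrite /= ?eqxx.
  by split; [exact: repvU|exact: boundedU|exact: repmV].
move=> s1 [[v1 b1 m1] x1].
apply: (@runs_seq _ _ _ _ _ _ (fun s => J1 s /\ s (cell 1 (size env) 0) = 0)).
  apply: runs_assign => //; split; last by rewrite /= ?eqxx.
  split; last by rewrite /= cell_neq.
  by split; [exact: repvV|exact: boundedU|exact: repmV].
move=> s2 [[J2 x2] y2]; apply: runs_seq.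
  apply: (runs_halve (J := J) L0 be _ _ _ J2 x2 y2).
  + by move=> s3 [].
  + move=> s3 v [v3 b3 m3] vL; split; [exact: repvV| |exact: repmV].
    by apply: boundedU => //; apply: leq_var.
  by move=> s3 v [v3 b3 m3] vL; split; [exact: repvU|exact: boundedU|exact: repmV].
move=> s3 [[v3 b3 m3] [k [vk ek kL]]].
have [||t [s' [x l [v4 b4 h4]]]] := IHp (rcons env k) _ _ s3 _ _ m3 b3 (w k ek kL).
- by rewrite all_rcons envL andbT /=; lia.
- exact: repv_rcons.
rewrite size_rcons in x l; exists t, s'; split=> //.
by have [] := repv_belast v4.
Qed.

(** * The program *)

Fixpoint fresh (r : nat) (e : ex) : bool :=
  match e with
  | EC _ | EI _ => true
  | ER r' _ _ => r' != r
  | EB _ e1 e2 => fresh r e1 && fresh r e2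
  | EZ e1 e2 e3 => [&& fresh r e1, fresh r e2 & fresh r e3]
  end.

Definition same_off (rs : seq nat) (g g' : arrays) :=
  forall r i j, r \notin rs -> g' r i j = g r i j.

Lemma ev_fresh r e env g g' : fresh r e -> same_off [:: r] g g' ->
  ev env g' e = ev env g e.
Proof.
move=> + h; elim: e => //= [r' i j rr|o e1 IH1 e2 IH2 /andP [f1 f2]|].
- by rewrite h // inE.
- by rewrite IH1 ?IH2.
by move=> e1 IH1 e2 IH2 e3 IH3 /and3P [f1 f2 f3]; rewrite IH1 ?IH2 ?IH3.
Qed.

Lemma same_off_trans rs g1 g2 g3 :
  same_off rs g1 g2 -> same_off rs g2 g3 -> same_off rs g1 g3.
Proof. by move=> h1 h2 r i j hr; rewrite h2 ?h1. Qed.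

Lemma same_offW rs rs' g g' : all [in rs'] rs -> same_off rs g g' -> same_off rs' g g'.
Proof. by move=> /allP hs h r i j hr; apply: h; apply: contra hr => /hs. Qed.

Lemma wp_seq L p q env Q g : wp L p env (wp L q env Q) g -> wp L (Sq p q) env Q g.
Proof. by []. Qed.

Lemma wp_fill L r a b e env (Q : arrays -> Prop) (g : arrays) :
  (forall i j, (i < nth 0 env a)%N -> (j < nth 0 env b)%N ->
     (`|ev (env ++ [:: i; j]) g e| <= 2 ^ L)%N) ->
  (forall g' : arrays, same_off [:: r] g g' ->
     (forall i j, g' r i j = if (i < nth 0 env a)%N && (j < nth 0 env b)%N
                             then ev (env ++ [:: i; j]) g e else g r i j) ->
     Q g') ->
  wp L (Fill r a b e) env Q g.
Proof.
move=> hb hQ; split=> //; apply: hQ => [r' i j|i j]; last by rewrite /fill eqxx.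
by rewrite inE /fill => /negbTE ->.
Qed.

Lemma wp_for L a p env (Q : arrays -> Prop) g (I : nat -> arrays -> Prop) :
  I 0%N g ->
  (forall k g, (k < nth 0 env a)%N -> I k g -> wp L p (rcons env k) (I k.+1) g) ->
  (forall g, I (nth 0%N env a) g -> Q g) ->
  wp L (For a p) env Q g.
Proof. by move=> h1 h2 h3; exists I. Qed.

Lemma wp_bits L e p env (Q : arrays -> Prop) g :
  (`|ev env g e| <= 2 ^ L)%N ->
  (forall k, ev env g e < (2 ^ k)%N -> wp L p (rcons env k) Q g) ->
  wp L (LetBits e p) env Q g.
Proof. by move=> h1 h2; split=> // k hk _; apply: h2. Qed.

Arguments wp : simpl never.

Lemma absz_sum_le n (F : nat -> int) b :
  (forall i, (i < n)%N -> (`|F i| <= b)%N) -> (`|(\sum_(i < n) F i)%R| <= n * b)%N.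
Proof.
elim: n => [|n IH] h; first by rewrite big_ord0.
rewrite big_ord_recr /= mulSn.
move: (h n (ltnSn n)) (IH (fun i hi => h i (ltnW hi))).
by move: (F n) (bigop _ _ _) (n * b)%N => x y z; lia.
Qed.

(* [acc d r a b c e] stores in r the sum of e over the variable d, where the  *)
(* variables d + 1 and d + 2 are the indices in r. *)
Definition acc (d r a b c : nat) (e : ex) : prog :=
  Sq (Fill r a b (EC 0))
     (For c (Fill r a b (EB Add (ER r (IV d.+1) (IV d.+2)) e))).

Lemma wp_acc L d r a b c e env (Q : arrays -> Prop) (g : arrays) :
  size env = d -> (a < d)%N -> (b < d)%N -> fresh r e ->
  (forall l i j, (l <= nth 0 env c)%N -> (i < nth 0 env a)%N -> (j < nth 0 env b)%N ->
     (`|(\sum_(k < l) ev (env ++ [:: val k; i; j]) g e)%R| <= 2 ^ L)%N) ->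
  (forall g' : arrays, same_off [:: r] g g' ->
     (forall i j, (i < nth 0 env a)%N -> (j < nth 0 env b)%N ->
        g' r i j = \sum_(l < nth 0%N env c) ev (env ++ [:: val l; i; j]) g e) ->
     Q g') ->
  wp L (acc d r a b c e) env Q g.
Proof.
move=> sd ad bd fe hb hQ; apply/wp_seq/wp_fill => // g0 h0 e0.
pose I l g' := same_off [:: r] g g' /\
  forall i j, (i < nth 0 env a)%N -> (j < nth 0 env b)%N ->
    g' r i j = \sum_(k < l) ev (env ++ [:: val k; i; j]) g e.
apply: (@wp_for _ _ _ _ _ _ I).
- by split=> // i j hi hj; rewrite e0 hi hj big_ord0.
- move=> l g' hl [h1 h2].
  have na : nth 0%N (rcons env l) a = nth 0%N env a by rewrite nth_rcons sd ad.
  have nb : nth 0%N (rcons env l) b = nth 0%N env b by rewrite nth_rcons sd bd.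
  have eE i j : (i < nth 0 env a)%N -> (j < nth 0 env b)%N ->
    ev (rcons env l ++ [:: i; j]) g' (EB Add (ER r (IV d.+1) (IV d.+2)) e) =
    \sum_(k < l.+1) ev (env ++ [:: val k; i; j]) g e.
    move=> hi hj; rewrite big_ord_recr /= cat_rcons (ev_fresh _ fe h1).
    have -> : nth 0%N (env ++ [:: l; i; j]) d.+1 = i.
      by rewrite nth_cat sd ltnNge leqnSn /= subSnn.
    have -> : nth 0%N (env ++ [:: l; i; j]) d.+2 = j.
      by rewrite nth_cat sd ltnNge !leqW //= -addn2 addKn.
    by rewrite h2.
  apply: wp_fill; rewrite na nb; first by move=> i j hi hj; rewrite eE // hb.
  move=> g2 h3 e3.
  split; first exact: same_off_trans h1 h3.
  by move=> i j hi hj; rewrite e3 hi hj eE.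
by move=> g' [h1 h2]; apply: hQ.
Qed.

(* Variables: 0 is m, 1 is n, 2 is m + n, 3 is n + 2, 4 is 1 and, in the      *)
(* elimination, 5 is the number of Euclidean divisions to be performed.       *)
(* Arrays: 0 is the input and the output, 1 is B = A_tau, 2 is the current    *)
(* [fl_mat B t], 3 is B times it, 4 its trace, 5 is the previous [fl_mat B t] *)
(* and 6 the current [fl_coef B t], 7 is the modulus d, 8 and 9 the system    *)
(* modulo d, 10 the indicator of S, 11 that of the set to be tried, 12 the    *)
(* tableau of the elimination, 13 the sum of what remains of the right-hand   *)
(* side, 14 the solution modulo d, 15 its image, 16 its correction on tau.    *)
Definition A_at (i j : ix) : ex := ER 0 (IA (IC 2) (IA (IM i (IV 1)) j)) (IC 0).
Definition b_at (i : ix) : ex := ER 0 (IA (IC 2) (IA (IM (IV 0) (IV 1)) i)) (IC 0).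
Definition tau_at (k : ix) : ex :=
  ER 0 (IA (IC 2) (IA (IM (IV 0) (IV 1)) (IA (IV 0) k))) (IC 0).

(** Index expressions cannot read arrays, so the column with index tau_k is obtained by summing over
    all columns those whose index matches. *)
Definition p_select : prog :=
  acc 5 1 0 0 1 (EZ (EB Defs.Sub (tau_at (IV 7)) (EI (IV 5)))
                    (A_at (IV 6) (IV 5)) (EC 0)).

(** Array 5 is one step behind array 2: after [m] rounds it holds [fl_mat B (m - 1)], the multiple
    of the inverse belonging to the coefficient in array 6. *)
Definition p_adjugate : prog :=
  Sq (Fill 2 0 0 (EZ (EB Defs.Sub (EI (IV 5)) (EI (IV 6))) (EC 1) (EC 0)))
  (For 0
    (Sq (Fill 5 0 0 (ER 2 (IV 6) (IV 7)))
    (Sq (acc 6 3 0 0 0 (EB Mul (ER 1 (IV 7) (IV 6)) (ER 2 (IV 6) (IV 8))))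
    (Sq (acc 6 4 4 4 0 (ER 3 (IV 6) (IV 6)))
    (Sq (Fill 6 4 4 (EB Div (EB Defs.Sub (EC 0) (ER 4 (IC 0) (IC 0)))
                            (EI (IA (IV 5) (IC 1)))))
        (Fill 2 0 0 (EB Add (ER 3 (IV 6) (IV 7))
            (EZ (EB Defs.Sub (EI (IV 6)) (EI (IV 7))) (ER 6 (IC 0) (IC 0)) (EC 0))))))))).

Definition p_reduce : prog :=
  let coef := EB Mul (ER 6 (IC 0) (IC 0)) (ER 5 (IV 6) (IV 5)) in
  Sq (Fill 7 4 4 (EB Mul (ER 6 (IC 0) (IC 0)) (ER 6 (IC 0) (IC 0))))
  (Sq (acc 5 8 0 1 0 (EB Mul (EB Defs.Sub (EC 0) coef) (A_at (IV 5) (IV 7))))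
      (acc 5 9 0 4 0 (EB Mul (EB Defs.Sub (EC 0) coef) (b_at (IV 5))))).

Definition emod (e : ex) : ex :=
  EB Defs.Sub e (EB Mul (ER 7 (IC 0) (IC 0)) (EB Div e (ER 7 (IC 0) (IC 0)))).

Definition p_start : prog :=
  Sq (Fill 12 3 2 (EZ (EB Defs.Sub (EI (IV 8)) (EI (IA (IV 0) (IV 7))))
                      (ER 11 (IV 7) (IC 0)) (EC 0)))
  (Sq (Fill 12 1 0 (EB Mul (ER 11 (IV 7) (IC 0)) (emod (ER 8 (IV 8) (IV 7)))))
      (Fill 12 3 0 (EZ (EB Defs.Sub (EI (IV 7)) (EI (IA (IV 1) (IC 1))))
                       (emod (ER 9 (IV 8) (IC 0))) (ER 12 (IV 7) (IV 8))))).

Definition p_euclid : prog :=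
  let g a k := ER 12 a k in
  let j := IV 8 in let i := IV 7 in let a := IV 10 in let k := IV 11 in
  let nn := IV 1 in
  Fill 12 3 2
    (EZ (g j i) (g a k)
      (EZ (EB Defs.Sub (EI a) (EI j))
        (emod (EB Defs.Sub (g nn k) (EB Mul (EB Div (g nn i) (g j i)) (g j k))))
        (EZ (EB Defs.Sub (EI a) (EI nn)) (g j k) (g a k)))).

Definition p_solve : prog :=
  let g a k := ER 12 a k in
  let i := IV 7 in let a := IV 8 in let k := IV 9 in
  let nn := IV 1 in let n1 := IA (IV 1) (IC 1) in
  Sq p_start
  (Sq (For 0
    (Sq (Fill 12 3 2 (EZ (EB Defs.Sub (EI a) (EI nn))
           (EZ (EB Defs.Sub (EI k) (EI i)) (ER 7 (IC 0) (IC 0)) (EC 0)) (g a k)))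
    (Sq (For 1 (For 5 p_euclid))
        (Fill 12 3 2 (EZ (EB Defs.Sub (EI a) (EI n1))
          (emod (EB Defs.Sub (g n1 k) (EB Mul (EB Div (g n1 i) (g nn i)) (g nn k))))
          (g a k))))))
    (acc 7 13 4 4 0 (ER 12 n1 (IV 7)))).

Definition p_try : prog :=
  let f := ER 13 (IC 0) (IC 0) in
  Sq p_solve
  (Sq (Fill 14 1 4 (EZ f (EB Defs.Sub (EC 0) (ER 12 (IA (IV 1) (IC 1)) (IA (IV 0) (IV 7))))
                         (ER 14 (IV 7) (IV 8))))
      (Fill 10 1 4 (EZ f (ER 11 (IV 7) (IV 8)) (ER 10 (IV 7) (IV 8))))).

(** The first loop runs once, with the full set. As a loop it binds a variable, so that [p_try] sees
    the same levels as in the second loop, where column after column is tentatively removed. *)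
Definition p_greedy : prog :=
  let dd := ER 7 (IC 0) (IC 0) in
  Sq (Fill 10 1 4 (EC 1))
  (Sq (Fill 14 1 4 (EC 0))
  (LetBits (EB Mul (EC 2) (EB Mul dd dd))
    (Sq (For 4 (Sq (Fill 11 1 4 (ER 10 (IV 7) (IV 8))) p_try))
        (For 1 (Sq (Fill 11 1 4 (EZ (EB Defs.Sub (EI (IV 7)) (EI (IV 6)))
                                    (EC 0) (ER 10 (IV 7) (IV 8)))) p_try))))).

(** The defect of the solution modulo [d], divided by [d], is added on the coordinates in tau. As in
    [p_select], indirect access is replaced by a sum over matching indices. *)
Definition p_output : prog :=
  Sq (acc 5 15 0 4 1 (EB Mul (ER 8 (IV 6) (IV 5)) (ER 14 (IV 5) (IC 0))))
  (Sq (acc 5 16 1 4 0 (EZ (EB Defs.Sub (tau_at (IV 5)) (EI (IV 6)))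
         (EB Div (EB Defs.Sub (ER 9 (IV 5) (IC 0)) (ER 15 (IV 5) (IC 0)))
                 (ER 7 (IC 0) (IC 0)))
         (EC 0)))
      (Fill 0 1 4 (EB Add (ER 14 (IV 5) (IC 0)) (ER 16 (IV 5) (IC 0))))).

Definition p_main : prog :=
  Sq p_select (Sq p_adjugate (Sq p_reduce (Sq p_greedy p_output))).

(** * Correctness of the greedy elimination *)

Section Greedy.
Variables (m n L K D : nat) (d : int) (C : nat -> nat -> int) (c : nat -> int).
Hypotheses (d0 : 0 < d) (dD : (`|d| <= D)%N) (mDL : (m.+1 * D <= 2 ^ L)%N).
Hypothesis dK : 2 * d ^+ 2 < (2 ^ K)%N%:Z.
Local Notation env1 := [:: m; n; (m + n)%N; n.+2; 1%N; K].
Local Notation sound := (sound m n d C c).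
Local Notation feas := (mod_feasible m n d C c).
Local Notation solution := (mod_solution m n d C c).
Local Notation spanned := (spanned m n d).
Local Notation pivoting := (pivoting m n d).

Definition data (g : arrays) :=
  [/\ g 7%N 0%N 0%N = d,
      forall k j, (k < m)%N -> (j < n)%N -> g 8%N k j = C k j
    & forall k, (k < m)%N -> g 9%N k 0%N = c k].

Lemma data_off rs g g' : same_off rs g g' -> all [predC rs] [:: 7; 8; 9]%N ->
  data g -> data g'.
Proof.
move=> h /and4P [r7 r8 r9 _] [h1 h2 h3].
by split=> *; rewrite h // ?h1 ?h2 ?h3.
Qed.

Let DL : (D <= 2 ^ L)%N.
Proof. by apply: leq_trans mDL; rewrite leq_pmull. Qed.

Let rangeD (z : int) : 0 <= z <= d -> (`|z| <= D)%N.
Proof. by move=> /andP [z0 zd]; apply: leq_trans dD; lia. Qed.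

Let L1 : (1 <= 2 ^ L)%N. Proof. by rewrite expn_gt0. Qed.

Definition binary (S : nat -> int) := forall j, (j < n)%N -> S j = 0 \/ S j = 1.

Lemma wp_start x (Q : arrays -> Prop) (g : arrays) : data g ->
  binary (fun j => g 11%N j 0%N) ->
  (forall g' : arrays, same_off [:: 12%N] g g' ->
     start m n d C c (fun j => g 11%N j 0%N) (g' 12%N) -> Q g') ->
  wp L p_start (rcons env1 x) Q g.
Proof.
move=> dg hS hQ; have [g7 g8 g9] := dg.
have md (z : int) : (`|(z %% d)%Z| <= 2 ^ L)%N.
  by apply: leq_trans (rangeD (modz_range d0 z)) DL.
have cond (k a : nat) : (k%:Z - (m + a)%N%:Z == 0) = (k == m + a)%N by rewrite subr_eq0.
apply/wp_seq/wp_fill => /= [a k an kw|g1 h1 e1].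
  rewrite cond; case: eqP => // e; have an' : (a < n)%N by lia.
  by case: (hS a an') => ->.
have g12 r i j : r != 12%N -> g1 r i j = g r i j by move=> h; rewrite h1 // inE.
apply/wp_seq/wp_fill => /= [a k an km|g2 h2 e2].
  rewrite /= -modzE !g12 // g7 g8 // abszM.
  by case: (hS a an) => ->; rewrite ?mul0n ?mul1n.
have g22 r i j : r != 12%N -> g2 r i j = g r i j.
  by move=> h; rewrite h2 ?g12 // inE.
have g2E a k : (a < n.+2)%N -> (k < m + n)%N -> g2 12%N a k =
    if (k < m)%N then if (a < n)%N then g 11%N a 0%N * (C k a %% d)%Z else 0
    else if k == (m + a)%N then g 11%N a 0%N else 0.
  move=> an kw; rewrite e2 /= -modzE (g12 7%N) // (g12 8%N) // (g12 11%N) // g7 e1 an kw /= cond.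
  case: (ltnP k m) => km; rewrite ?andbF //.
  by rewrite andbT; case: ifP => an'; [rewrite g8|rewrite ltn_eqF // ltn_addr].
have g2b a k : (a < n.+2)%N -> (k < m + n)%N -> (`|g2 12%N a k| <= 2 ^ L)%N.
  move=> an kw; rewrite g2E //; case: ifP => km.
    case: ifP => // an'; rewrite abszM.
    by case: (hS a an') => ->; rewrite ?mul0n ?mul1n.
  case: eqP => // e; have an' : (a < n)%N by lia.
  by case: (hS a an') => ->.
have cond1 (a : nat) : (a%:Z - (n + 1)%N%:Z == 0) = (a == n.+1) by rewrite subr_eq0 addn1.
apply/wp_fill => /= [a k an km|g3 h3 e3]; rewrite ?cond1 /= -?modzE.
  by case: ifP => _; [rewrite (g22 7%N) // g7|rewrite g2b // ltn_addr].
apply: hQ => [|a k an kw].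
  apply: (same_off_trans h1); apply: (same_off_trans h2); exact: h3.
rewrite e3 an /= cond1 -modzE (g22 7%N) // (g22 9%N) // g7 g2E //.
case: (boolP (k < m)%N) => //= km; rewrite g9 //.
by case: (ltnP a n) => // an'; rewrite ltn_eqF // leqW.
Qed.

Let rowD S G a k : sound S G -> (a < n.+2)%N -> (k < m + n)%N -> (`|G a k| <= 2 ^ L)%N.
Proof. by move=> sG an kw; have [h _ _] := sG a an; apply: leq_trans (rangeD (h k kw)) DL. Qed.

(** Soundness is carried through the loops unconditionally, [spanned] and [pivoting] only under
    feasibility. Thus a zero sum yields a solution, and a nonzero one refutes feasibility. *)
Lemma wp_solve x (Q : arrays -> Prop) (g : arrays) (S := fun j => g 11%N j 0%N) :
  data g -> binary S ->
  (forall g' : arrays, same_off [:: 12; 13]%N g g' -> sound S (g' 12%N) ->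
     g' 13%N 0%N 0%N = \sum_(k < m) g' 12%N n.+1 k ->
     (feas S -> g' 13%N 0%N 0%N = 0) -> Q g') ->
  wp L p_solve (rcons env1 x) Q g.
Proof.
move=> dg hS hQ; apply/wp_seq/wp_start => // g1 h1 st1.
pose I i (g' : arrays) := [/\ same_off [:: 12%N] g g', sound S (g' 12%N) &
                     feas S -> spanned i (g' 12%N)].
have dat g' : same_off [:: 12%N] g g' -> g' 7%N 0%N 0%N = d.
  by move=> h; rewrite h //; case: dg.
apply/wp_seq/(wp_for (I := I)) => /=.
- by split=> //; [exact: start_sound st1|exact: start_spanned st1].
- move=> i g2 im [h2 s2 p2]; have iw : (i < m + n)%N by apply: ltn_addr.
  have cond (a k : nat) : (a%:Z - k%:Z == 0) = (a == k) by rewrite subr_eq0.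
  apply/wp_seq/wp_fill => /= [a k an kw|g3 h3 e3]; rewrite ?cond.
    case: ifP => _; last exact: rowD s2 an kw.
    by case: ifP => _ //; rewrite (dat _ h2) (leq_trans dD).
  have {}e3 a k : (a < n.+2)%N -> (k < m + n)%N ->
      g3 12%N a k = if a == n then (if k == i then d else 0) else g2 12%N a k.
    by move=> an kw; rewrite e3 an kw /= !cond (dat _ h2).
  have [s3 p3] := pivot_init d0 im s2 e3.
  have {}h3 : same_off [:: 12%N] g g3 by apply: same_off_trans h2 h3.
  pose J j (g' : arrays) := [/\ same_off [:: 12%N] g g', sound S (g' 12%N) &
                       feas S -> pivoting i j (g' 12%N)].
  apply/wp_seq/(wp_for (I := J)) => /=.
  + by split=> // /p2 /p3.
  + move=> j g4 jn [h4 s4 p4].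
    pose T t (g' : arrays) := [/\ same_off [:: 12%N] g g', sound S (g' 12%N) &
      feas S -> pivoting i j (g' 12%N) /\ progress n d i j t (g' 12%N)].
    apply: (wp_for (I := T)) => /=.
    * split=> // fS; split; first exact: p4.
      exact: (progress0 d0 im jn s4).
    * move=> t g5 tK [h5 s5 p5]; rewrite /p_euclid.
      set val := EZ _ _ _.
      have valE a k : ev [:: m; n; (m + n)%N; n.+2; 1%N; K; x; i; j; t; a; k] g5 val =
        if g5 12%N j i == 0 then g5 12%N a k
        else if a == j then ((g5 12%N n k - (g5 12%N n i %/ g5 12%N j i)%Z * g5 12%N j k) %% d)%Z
        else if a == n then g5 12%N j k else g5 12%N a k.
        by rewrite /= /= -modzE !cond (dat _ h5).
      have st : euclid_step m n d i j (g5 12%N) (fun a k =>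
          ev [:: m; n; (m + n)%N; n.+2; 1%N; K; x; i; j; t; a; k] g5 val).
        by move=> a k _ _; apply: valE.
      apply: wp_fill => [a k /= an kw|g6 h6 e6].
        exact: (rowD (euclid_sound d0 jn s5 st)).
      have st6 : euclid_step m n d i j (g5 12%N) (g6 12%N).
        by move=> a k an kw; rewrite e6 /= an kw -valE.
      split; first exact: same_off_trans h5 h6.
        exact: (euclid_sound d0 jn s5 st6).
      move=> /p5 [p5a p5b]; split; first exact: (euclid_pivoting im jn s5 st6).
      exact: (euclid_progress d0 im jn s5 st6).
    move=> g5 [h5 s5 p5]; split=> // /p5 [p5a p5b].
    exact: (progress_end im jn s5 p5a p5b dK).
  move=> g4 [h4 s4 p4].
  set val := EZ _ _ _.
  have valE a k : ev [:: m; n; (m + n)%N; n.+2; 1%N; K; x; i; a; k] g4 val =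
      if a == n.+1 then ((g4 12%N n.+1 k - (g4 12%N n.+1 i %/ g4 12%N n i)%Z * g4 12%N n k) %% d)%Z
      else g4 12%N a k.
    by rewrite /= /= -modzE !addn1 !cond (dat _ h4).
  have st : reduce m n d i (g4 12%N) (fun a k =>
      ev [:: m; n; (m + n)%N; n.+2; 1%N; K; x; i; a; k] g4 val).
    by move=> a k _ _; apply: valE.
  apply: wp_fill => [a k /= an kw|g5 h5 e5].
    by have [sv _] := reduce_ok d0 im s4 st; apply: (rowD sv).
  have st5 : reduce m n d i (g4 12%N) (g5 12%N).
    by move=> a k an kw; rewrite e5 /= an kw -valE.
  have [s5 p5] := reduce_ok d0 im s4 st5.
  by split=> //; [exact: same_off_trans h4 h5|move=> /p4 /p5].
move=> g2 [h2 s2 p2]; apply: wp_acc => //= [l i j lm _ _|g3 h3 e3].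
  apply: leq_trans (absz_sum_le (F := fun k => g2 12%N (n + 1)%N k) (b := D) _) _.
    move=> k kl; rewrite addn1; apply: rangeD; have [h _ _] := s2 n.+1 (ltnSn _).
    by apply: h; apply: ltn_addr; apply: leq_trans kl lm.
  by apply: leq_trans mDL; rewrite leq_mul2r (leq_trans lm) ?orbT.
have e12 a k : g3 12%N a k = g2 12%N a k by rewrite h3.
have e13 : g3 13%N 0%N 0%N = \sum_(k < m) g2 12%N n.+1 k.
  by rewrite e3 //; apply: eq_bigr => k _; rewrite addn1.
apply: hQ.
- by apply: same_off_trans (same_offW _ h2) (same_offW _ h3).
- move=> a an; have [q1 q2 q3] := s2 a an; split.
  + by move=> k kw; rewrite e12 q1.
  + by move=> j jn Sj; rewrite e12 q2.
  move=> k km; rewrite e12 (eq_bigr (fun j : 'I_n => C k j * g2 12%N a (m + j)%N)) ?q3 //.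
  by move=> j _; rewrite e12.
- by rewrite e13; apply: eq_bigr => k _; rewrite e12.
by move=> /p2 /spanned_end h; rewrite e13.
Qed.

Definition small (x : nat -> int) := forall j, (j < n)%N -> (`|x j| <= D)%N.

Lemma wp_try x (Q : arrays -> Prop) (g : arrays) (S := fun j => g 11%N j 0%N) :
  data g -> binary S -> binary (fun j => g 10%N j 0%N) ->
  small (fun j => g 14%N j 0%N) ->
  (forall g' : arrays, same_off [:: 10; 12; 13; 14]%N g g' ->
     small (fun j => g' 14%N j 0%N) ->
     (solution S (fun j => g' 14%N j 0%N) /\
        forall j, (j < n)%N -> g' 10%N j 0%N = S j) \/
     (~ feas S /\ forall j, (j < n)%N ->
        g' 10%N j 0%N = g 10%N j 0%N /\ g' 14%N j 0%N = g 14%N j 0%N) -> Q g') ->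
  wp L p_try (rcons env1 x) Q g.
Proof.
move=> dg hS h10 h14 hQ; apply/wp_seq/wp_solve => // g1 o1 s1 e1 f1.
have [q1 q2 q3] := s1 n.+1 (ltnSn _).
have neg j : (j < n)%N -> (`|- g1 12%N n.+1 (m + j)%N| <= D)%N.
  by move=> jn; rewrite abszN; apply: rangeD; apply: q1; rewrite ltn_add2l.
apply/wp_seq/wp_fill => /= [j i jn|g2 o2 e2].
  rewrite ltnS leqn0 => /eqP ->; case: ifP => _; last first.
    by rewrite o1 //; apply: leq_trans (h14 j jn) DL.
  by rewrite sub0r addn1; apply: leq_trans (neg j jn) DL.
have {}e2 j : (j < n)%N -> g2 14%N j 0%N =
    if g1 13%N 0%N 0%N == 0 then - g1 12%N n.+1 (m + j)%N else g 14%N j 0%N.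
  by move=> jn; rewrite e2 jn /= sub0r addn1 (o1 14%N).
have e13 : g2 13%N 0%N 0%N = g1 13%N 0%N 0%N by rewrite o2.
have bin1 (z : int) : z = 0 \/ z = 1 -> (`|z| <= 2 ^ L)%N by case=> ->.
apply/wp_fill => /= [j i jn|g3 o3 e3].
  rewrite ltnS leqn0 => /eqP ->.
  by case: ifP => _; rewrite o2 // o1 //; apply: bin1; [apply: hS|apply: h10].
have {}e3 j : (j < n)%N -> g3 10%N j 0%N =
    if g1 13%N 0%N 0%N == 0 then S j else g 10%N j 0%N.
  by move=> jn; rewrite e3 jn /= e13 !o2 // (o1 11%N) // (o1 10%N).
have e14 j : (j < n)%N -> g3 14%N j 0%N =
    if g1 13%N 0%N 0%N == 0 then - g1 12%N n.+1 (m + j)%N else g 14%N j 0%N.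
  by move=> jn; rewrite o3 // e2.
apply: hQ.
- apply: (same_off_trans (g2 := g1)); first exact: same_offW o1.
  apply: (same_off_trans (g2 := g2)); first exact: same_offW o2.
  exact: same_offW o3.
- by move=> j jn /=; rewrite e14 //; case: ifP => _; [apply: neg|apply: h14].
have [z|nz] := eqVneq (g1 13%N 0%N 0%N) 0; [left|right]; split.
- apply: (mod_solution_ext _ _ (sound_solution s1 _)) => //.
    by move=> j jn; rewrite e14 // z eqxx.
  by rewrite -e1.
- by move=> j jn; rewrite e3 // z eqxx.
- by move=> /f1 z; rewrite z eqxx in nz.
by move=> j jn; rewrite e3 // e14 // (negbTE nz).
Qed.

Definition without (S : nat -> int) (j : nat) : nat -> int :=
  fun i => if i == j then 0 else S i.

End Greedy.

(** One pass suffices for minimality: a column that could not be dropped from a set cannot be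
    dropped from a smaller one, by [mod_feasible_mono]. *)
Lemma wp_greedy m n L D d C c (Q : arrays -> Prop) (g : arrays) :
  0 < d -> (`|d| <= D)%N -> (m.+1 * D <= 2 ^ L)%N -> (2 * D ^ 2 <= 2 ^ L)%N ->
  data m n d C c g -> mod_feasible m n d C c (fun=> 1) ->
  (forall g' : arrays, same_off [:: 10; 11; 12; 13; 14]%N g g' ->
     let S := fun j => g' 10%N j 0%N in let x := fun j => g' 14%N j 0%N in
     binary n S -> small n D x -> mod_solution m n d C c S x ->
     (forall j, (j < n)%N -> S j = 1 -> ~ mod_feasible m n d C c (without S j)) ->
     Q g') ->
  wp L p_greedy [:: m; n; (m + n)%N; n.+2; 1%N] Q g.
Proof.
move=> d0 dD mDL DDL dg f1 hQ.
have L1 : (1 <= 2 ^ L)%N by rewrite expn_gt0.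
apply/wp_seq/wp_fill => //= g1 o1 e1; apply/wp_seq/wp_fill => //= g2 o2 e2.
have o12 : same_off [:: 10; 14]%N g g2.
  by apply: (same_off_trans (g2 := g1)); [apply: same_offW o1|apply: same_offW o2].
have d2 : data m n d C c g2 by apply: data_off o12 _ dg.
have g7 : g2 7%N 0%N 0%N = d by case: d2.
apply: wp_bits => /= [|K]; rewrite g7.
  rewrite !abszM; apply: leq_trans DDL.
  by rewrite leq_mul2l /= -mulnn leq_mul.
rewrite -expr2 => dK.
pose fin (g' : arrays) := [/\ same_off [:: 10; 11; 12; 13; 14]%N g g',
  binary n (fun j => g' 10%N j 0%N), small n D (fun j => g' 14%N j 0%N)
  & mod_solution m n d C c (fun j => g' 10%N j 0%N) (fun j => g' 14%N j 0%N)].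
(* The loop has a single round, so its invariant only separates the initial state from the final
   one. *)
pose I1 t (g' : arrays) := if t is 0 then g' = g2 else fin g'.
have binL (z : int) : z = 0 \/ z = 1 -> (`|z| <= 2 ^ L)%N by case=> ->.
have S2 j : (j < n)%N -> g2 10%N j 0%N = 1 by move=> jn; rewrite o2 // e1 jn.
apply/wp_seq/(wp_for (I := I1)) => //=.
  move=> t g3; rewrite ltnS leqn0 => /eqP -> -> {t g3} /=.
  apply/wp_seq/wp_fill => /= [j i jn|g3 o3 e3].
    by rewrite ltnS leqn0 => /eqP ->; rewrite S2.
  have S3 j : (j < n)%N -> g3 11%N j 0%N = 1 by move=> jn; rewrite e3 jn /= S2.
  apply: (wp_try d0 dD mDL dK) => [||||g4 o4 sm4].
  - exact: data_off o3 _ d2.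
  - by move=> j jn; right; apply: S3.
  - by move=> j jn; right; rewrite o3 // S2.
  - by move=> j jn /=; rewrite o3 // e2 jn.
  have f3 : mod_feasible m n d C c (fun j => g3 11%N j 0%N).
    by apply: mod_feasible_mono f1 => j jn; rewrite S3.
  case=> [[sol e4]|[/(_ f3)] //]; split=> //.
  - apply: (same_off_trans (g2 := g2)); first exact: same_offW o12.
    by apply: (same_off_trans (g2 := g3)); [apply: same_offW o3|apply: same_offW o4].
  - by move=> j jn; rewrite e4 // S3 //; right.
  by apply: mod_solution_ext sol => // j jn; rewrite e4.
move=> g3 fin3.
pose I2 t (g' : arrays) := fin g' /\ forall j, (j < t)%N -> (j < n)%N ->
  g' 10%N j 0%N = 1 -> ~ mod_feasible m n d C c (without (fun j => g' 10%N j 0%N) j).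
apply: (wp_for (I := I2)) => /=; first by split.
- move=> t g4 tn [[o4 b4 sm4 sol4] min4] /=.
  have cond (i j : nat) : (i%:Z - j%:Z == 0) = (i == j) by rewrite subr_eq0.
  apply/wp_seq/wp_fill => /= [j i jn|g5 o5 e5].
    rewrite ltnS leqn0 => /eqP ->; case: ifP => // _; exact/binL/b4.
  have {}e5 j : (j < n)%N -> g5 11%N j 0%N = without (fun j => g4 10%N j 0%N) t j.
    by move=> jn; rewrite e5 jn /= cond.
  have b5 : binary n (fun j => g5 11%N j 0%N).
    by move=> j jn; rewrite e5 // /without; case: ifP => _; [left|apply: b4].
  have o45 : same_off [:: 10; 11; 12; 13; 14]%N g g5.
    by apply: (same_off_trans o4); apply: same_offW o5.
  apply: (wp_try d0 dD mDL dK) => [|//|||g6 o6 sm6].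
  - exact: data_off o45 _ dg.
  - by move=> j jn; rewrite o5 //; apply: b4.
  - by move=> j jn /=; rewrite o5 //; apply: sm4.
  have o46 : same_off [:: 10; 11; 12; 13; 14]%N g g6.
    by apply: (same_off_trans o45); apply: same_offW o6.
  case=> [[sol e6]|[nf e6]].
    have e6' j : (j < n)%N -> g6 10%N j 0%N = without (fun j => g4 10%N j 0%N) t j.
      by move=> jn; rewrite e6 // e5.
    split; first split=> //.
    + by move=> j jn; rewrite e6 //; apply: b5.
    + by apply: mod_solution_ext sol => // j jn; rewrite e6.
    move=> j; rewrite ltnS leq_eqVlt => /orP [/eqP ->|jt] jn.
      by rewrite e6' // /without eqxx.
    rewrite e6' // {1}/without (ltn_eqF jt) => S1 fs; apply: (min4 j jt jn S1).
    apply: mod_feasible_mono fs => i iN; rewrite /without.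
    case: eqP => // _ S0; rewrite e6' // /without; case: eqP => // _; exact: S0.
  split; first split=> //.
  + by move=> j jn; have [-> _] := e6 j jn; rewrite o5 //; apply: b4.
  + apply: mod_solution_ext sol4 => j jn; have [h10 h14] := e6 j jn.
      by rewrite h10 o5.
    by rewrite h14 o5.
  move=> j jt jn; have [-> _] := e6 j jn; rewrite o5 // => S1 fs.
  move: jt; rewrite ltnS leq_eqVlt => /orP [/eqP ejt|jt].
    rewrite {}ejt in fs; apply: nf; apply: mod_feasible_mono fs => i iN; rewrite e5 // /without.
    by case: eqP => // _; have [-> _] := e6 i iN; rewrite o5.
  apply: (min4 j jt jn S1); apply: mod_feasible_mono fs => i iN; rewrite /without.
  by case: eqP => // _; have [-> _] := e6 i iN; rewrite o5.
by move=> g4 [[o4 b4 sm4 sol4] min4]; apply: hQ => // j jn; apply: min4.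
Qed.

(** * Correctness of the program *)

Lemma absz_add_le (x y : int) a b :
  (`|x| <= a)%N -> (`|y| <= b)%N -> (`|(x + y)%R| <= a + b)%N.
Proof. lia. Qed.

(* If m and the entries of B are at most a, the entries of [fl_mat B t] grow  *)
(* at most by this factor at each step. *)
Definition growth (a : nat) : nat := (2 * a ^ 3)%N.

(** With entries of the current matrix at most u, those of its product with [B] are at most al^2 u
    and the trace is at most al^3 u; dividing does not enlarge it, and the sum is at most 2 al^3
    u. *)
Lemma fl_bound m (B : 'M[int]_m) al t :
  (forall i j, (`|B i j| <= al)%N) -> (m <= al)%N -> (0 < al)%N ->
  [/\ forall i j, (`|fl_mat B t i j| <= growth al ^ t)%N,
      forall i j, (`|(B *m fl_mat B t)%R i j| <= al ^ 2 * growth al ^ t)%N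
    & (`|fl_coef B t| <= al ^ 3 * growth al ^ t)%N].
Proof.
move=> hB mal al0.
have sum (F : 'I_m -> int) x : (forall k, (`|F k| <= x)%N) ->
    (`|(\sum_k F k)%R| <= al * x)%N.
  move=> h; apply: (@leq_trans (\sum_(k < m) x)%N); last first.
    by rewrite sum_nat_const card_ord leq_mul2r mal orbT.
  by apply: (big_ind2 (fun (y : int) z => (`|y| <= z)%N)) => // y z y' z'; lia.
have step u (M : 'M[int]_m) : (forall i j, (`|M i j| <= u)%N) ->
  (forall i j, (`|(B *m M)%R i j| <= al ^ 2 * u)%N) /\
  (`|(\tr (B *m M))%R| <= al ^ 3 * u)%N.
  move=> hM; have h i j : (`|(B *m M)%R i j| <= al ^ 2 * u)%N.
    by rewrite mxE expnS expn1 -mulnA; apply: sum => k; rewrite abszM leq_mul.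
  by split=> //; rewrite expnS -mulnA; apply: sum => k; apply: h.
have coef t' : (forall i j, (`|fl_mat B t' i j| <= growth al ^ t')%N) ->
    (`|fl_coef B t'| <= al ^ 3 * growth al ^ t')%N.
  move=> h; have [_ h4] := step _ _ h.
  by apply: leq_trans (lez_div _ _) _; rewrite abszN.
suff H : forall i j, (`|fl_mat B t i j| <= growth al ^ t)%N.
  have [h1 h2] := step _ _ H; split=> //; exact: (coef _ H).
elim: t => [|t IH] i j; first by rewrite /= mxE expn0; case: (i == j).
have [/(_ i j) h2 _] := step _ _ IH; have h4 := coef _ IH.
rewrite [fl_mat B t.+1]/= -/(fl_coef B t) mxE expnS.
have h5 : (`|((fl_coef B t)%:M : 'M_m) i j| <= al ^ 3 * growth al ^ t)%N.
  by rewrite mxE; case: (i == j); rewrite ?mulr1n ?mulr0n.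
apply: leq_trans (absz_add_le h2 h5) _.
by rewrite -mulnDl leq_mul2r {2}/growth mul2n -addnn leq_add2r leq_pexp2l // orbT.
Qed.

Section Verify.
Variables (m' n : nat).
Local Notation m := m'.+1.
Variables (A : 'M[int]_(m, n)) (b : 'cV[int]_m) (f : 'I_m -> 'I_n) (al L : nat).
Hypotheses (hA : forall i j, (`|A i j| <= al)%N) (hb : forall i, (`|b i 0%R| <= al)%N).
Hypotheses (mal : (m <= al)%N) (nal : (n <= al)%N).
Local Notation U := (growth al).
(** The reduced system and its solution are at most [U ^ (2 * m)], and products of two entries at
    most [U ^ (4 * m)]. The four additional factors cover the sum over the columns, the defect, the
    sum over tau and the final addition. *)
Hypothesis hL : (U ^ (4 * m).+4 <= 2 ^ L)%N.

Local Notation env0 := [:: m; n; (m + n)%N; n.+2; 1%N].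
Local Notation B := (colsub f A).

Definition inputs (g : arrays) :=
  [/\ forall (i : 'I_m) (j : 'I_n), g 0%N (2 + (i * n + j))%N 0%N = A i j,
      forall i : 'I_m, g 0%N (2 + (m * n + i))%N 0%N = b i 0
    & forall k : 'I_m, g 0%N (2 + (m * n + (m + k)))%N 0%N = (f k)%:Z].

Lemma inputs_off rs g g' : same_off rs g g' -> 0%N \notin rs -> inputs g -> inputs g'.
Proof. by move=> hs h0 [h1 h2 h3]; split=> *; rewrite hs. Qed.

Let al0 : (0 < al)%N. Proof. exact: leq_trans mal. Qed.

Let U1 : (1 < U)%N.
Proof. by rewrite /growth; have : (0 < al ^ 3)%N; [rewrite expn_gt0 al0|lia]. Qed.

Let alU : (al * al <= U)%N.
Proof. by apply: leq_trans (leq_pmull _ _) => //; rewrite mulnn leq_pexp2l. Qed.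

Let leL k : (k <= (4 * m).+4)%N -> (U ^ k <= 2 ^ L)%N.
Proof. by move=> h; apply: leq_trans hL; rewrite leq_pexp2l // ltnW. Qed.

Lemma wp_select Q (g : arrays) : inputs g ->
  (forall g' : arrays, same_off [:: 1%N] g g' -> (forall i k : 'I_m, g' 1%N i k = B i k) -> Q g') ->
  wp L p_select env0 Q g.
Proof.
move=> [gA gb gt] hQ; apply: wp_acc => //=.
- move=> l i j ln im jm.
  pose F k := if g 0%N (2 + (m * n + (m + j)))%N 0%N - k%:Z == 0
              then g 0%N (2 + (i * n + k))%N 0%N else 0.
  apply: leq_trans (absz_sum_le (F := F) (b := al) _) _.
    move=> k kl; rewrite /F; case: ifP => // _.
    by rewrite (gA (Ordinal im) (Ordinal (leq_trans kl ln))) hA.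
  apply: (@leq_trans (U ^ 1)); last exact: leL.
  by rewrite expn1; apply: leq_trans alU; rewrite leq_mul2r (leq_trans ln) ?orbT.
move=> g' h1 h2; apply: hQ => // i k; rewrite h2 // mxE (bigD1 (f k)) //= big1 ?addr0.
  by rewrite gt subrr eqxx gA.
move=> l lk; rewrite gt subr_eq0 ifF //; apply/negbTE.
by apply: contra lk => /eqP [e]; apply/eqP/val_inj.
Qed.

Lemma wp_adjugate Q (g : arrays) : (forall i k : 'I_m, g 1%N i k = B i k) ->
  (forall g' : arrays, same_off [:: 2; 3; 4; 5; 6]%N g g' ->
     (forall i k : 'I_m, g' 5%N i k = fl_mat B m' i k) ->
     g' 6%N 0%N 0%N = fl_coef B m' -> Q g') ->
  wp L p_adjugate env0 Q g.
Proof.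
move=> gB hQ.
have hB i j : (`|B i j| <= al)%N by rewrite mxE hA.
have fb t := fl_bound t hB mal al0.
have id_at (x y : int) (i j : 'I_m) :
    (if i%:Z - j%:Z == 0 then x else y) = if i == j then x else y.
  by rewrite subr_eq0.
apply/wp_seq/wp_fill => /= [i j _ _|g0 h0 e0].
  by case: ifP => _ //; rewrite expn_gt0.
pose I t g' := [/\ same_off [:: 2; 3; 4; 5; 6]%N g g',
  forall i k : 'I_m, g' 2%N i k = fl_mat B t i k &
  (0 < t)%N -> (forall i k : 'I_m, g' 5%N i k = fl_mat B t.-1 i k) /\
     g' 6%N 0%N 0%N = fl_coef B t.-1].
apply: (@wp_for _ _ _ _ _ _ I) => /=; last 1 first.
- by move=> g' [h1 h2 /(_ isT) [h3 h4]]; apply: hQ.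
- split=> //; first exact: same_offW h0.
  by move=> i k; rewrite e0 !ltn_ord id_at mxE; case: (i == k).
move=> t g1 tm [h1 h2 h3]; have [b1 b2 b3] := fb t.
apply/wp_seq/wp_fill => /= [i j im jm|g2 e2 e25].
  by rewrite (h2 (Ordinal im) (Ordinal jm)); apply: leq_trans (b1 _ _) (leL _); lia.
have eB (i k : 'I_m) : g2 1%N i k = B i k by rewrite e2 // h1.
have eM (i k : 'I_m) : g2 2%N i k = fl_mat B t i k by rewrite e2.
apply/wp_seq/wp_acc => //= [l i j lm im jm|g3 e3 h33].
  apply: leq_trans (absz_sum_le (F := fun k => g2 1%N i k * g2 2%N k j)
    (b := (al * U ^ t)%N) _) _.
    move=> k kl; have km := leq_trans kl lm.
    by rewrite (eB (Ordinal im) (Ordinal km)) (eM (Ordinal km) (Ordinal jm)) abszM leq_mul.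
  apply: (@leq_trans (U ^ t.+1)); last by apply: leL; lia.
  by rewrite mulnA expnS leq_mul2r (leq_trans _ alU) ?orbT // leq_mul2r (leq_trans lm) ?orbT.
have e33 (i k : 'I_m) : g3 3%N i k = (B *m fl_mat B t) i k.
  by rewrite h33 // mxE; apply: eq_bigr => l _; rewrite eB eM.
apply/wp_seq/wp_acc => //= [l i j lm _ _|g4 e4 h4].
  apply: leq_trans (absz_sum_le (F := fun k => g3 3%N k k) (b := (al ^ 2 * U ^ t)%N) _) _.
    move=> k kl; have km := leq_trans kl lm.
    by rewrite (e33 (Ordinal km) (Ordinal km)).
  apply: (@leq_trans (U ^ t.+1)); last by apply: leL; lia.
  rewrite mulnA [(U ^ t.+1)%N]expnS leq_mul2r; apply/orP; right.
  apply: (@leq_trans (al * al ^ 2)); first by rewrite leq_mul2r (leq_trans lm) ?orbT.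
  by rewrite -expnS /growth leq_pmull.
have e44 : g4 4%N 0%N 0%N = \tr (B *m fl_mat B t).
  by rewrite h4 //; apply: eq_bigr => l _; rewrite e33.
apply/wp_seq/wp_fill => /= [i j _ _|g5 e5 e56].
  rewrite e44 sub0r addn1; apply: leq_trans b3 _.
  apply: (@leq_trans (U ^ t.+1)); last by apply: leL; lia.
  by rewrite [(U ^ t.+1)%N]expnS leq_mul2r /growth leq_pmull ?orbT.
have {}e56 : g5 6%N 0%N 0%N = fl_coef B t by rewrite e56 /= e44 sub0r addn1.
have ev2 (i k : 'I_m) : g5 3%N i k + (if i%:Z - k%:Z == 0 then g5 6%N 0%N 0%N else 0)
  = fl_mat B t.+1 i k.
  have -> : fl_mat B t.+1 i k = (B *m fl_mat B t) i k + ((fl_coef B t)%:M : 'M_m) i k.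
    by rewrite [fl_mat B t.+1]/= mxE.
  rewrite e5 // e4 // e33 e56 id_at [X in _ = _ + X]mxE.
  by case: (i == k).
apply/wp_fill => /= [i j im jm|g6 e6 e62].
  rewrite (ev2 (Ordinal im) (Ordinal jm)); have [c1 _ _] := fb t.+1.
  by apply: leq_trans (c1 _ _) (leL _); lia.
split.
- apply: (same_off_trans h1); apply: (same_off_trans (g2 := g2)).
    exact: same_offW e2.
  apply: (same_off_trans (g2 := g3)); first exact: same_offW e3.
  apply: (same_off_trans (g2 := g4)); first exact: same_offW e4.
  apply: (same_off_trans (g2 := g5)); first exact: same_offW e5.
  exact: same_offW e6.
- by move=> i k; rewrite e62 !ltn_ord /= ev2.
move=> _; split; last by rewrite e6.
by move=> i k; rewrite e6 // e5 // e4 // e3 // e25 !ltn_ord h2.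
Qed.

Local Notation E := (fl_mat B m').
Local Notation c0 := (fl_coef B m').
Local Notation D := (U ^ (2 * m))%N.

(** Since [E *m B] is the scalar matrix [- c0], multiplying the system by [- c0 *: E] turns the
    columns of tau into [cmod] times unit vectors. The factor [- c0] makes the modulus a square,
    hence positive. *)
Definition cmat : 'M[int]_(m, n) := - c0 *: (E *m A).
Definition cvec : 'cV[int]_m := - c0 *: (E *m b).
Definition cmod : int := c0 * c0.

Lemma cmod_bound : (`|cmod| <= D)%N.
Proof.
have hB i j : (`|B i j| <= al)%N by rewrite mxE hA.
have [_ _ h] := fl_bound m' hB mal al0.
have {}h : (`|c0| <= U ^ m)%N.
  by apply: leq_trans h _; rewrite [(U ^ m)%N]expnS leq_mul2r /growth leq_pmull ?orbT.
by rewrite abszM mul2n -addnn expnD leq_mul.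
Qed.

(** The factor [c0] accounts for [U ^ m], an entry of [E] for [U ^ m'], and the entry [x] with the
    number of summands for one more [U]. *)
Lemma reduced_bound (x : 'I_m -> int) (F : nat -> int) l (i : 'I_m) :
  (forall j, (`|x j| <= al)%N) -> (l <= m)%N ->
  (forall k : 'I_m, F k = - c0 * E i k * x k) ->
  (`|(\sum_(k < l) F k)%R| <= D)%N.
Proof.
move=> hx lm hF.
have hB i' j : (`|B i' j| <= al)%N by rewrite mxE hA.
have [hE _ h] := fl_bound m' hB mal al0.
have {}h : (`|c0| <= U ^ m)%N.
  by apply: leq_trans h _; rewrite [(U ^ m)%N]expnS leq_mul2r /growth leq_pmull ?orbT.
apply: leq_trans (absz_sum_le (b := (U ^ m * U ^ m' * al)%N) _) _.
  move=> k kl; rewrite (hF (Ordinal (leq_trans kl lm))) !abszM abszN.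
  by rewrite !leq_mul.
have -> : D = (U * (U ^ m * U ^ m'))%N by rewrite -expnD -expnS; congr (_ ^ _)%N; lia.
rewrite mulnCA [leqRHS]mulnC leq_mul2l; apply/orP; right.
by apply: leq_trans alU; rewrite leq_mul2r (leq_trans lm) ?orbT.
Qed.

Lemma wp_reduce Q (g : arrays) : inputs g ->
  (forall i k : 'I_m, g 5%N i k = E i k) -> g 6%N 0%N 0%N = c0 ->
  (forall g' : arrays, same_off [:: 7; 8; 9]%N g g' ->
     g' 7%N 0%N 0%N = cmod ->
     (forall (k : 'I_m) (j : 'I_n), g' 8%N k j = cmat k j) ->
     (forall k : 'I_m, g' 9%N k 0%N = cvec k 0) -> Q g') ->
  wp L p_reduce env0 Q g.
Proof.
move=> ig gE gc hQ.
have DL : (D <= 2 ^ L)%N by apply: leL; lia.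
apply/wp_seq/wp_fill => /= [i j _ _|g1 o1 e1]; first by rewrite gc (leq_trans cmod_bound).
have [i1 i2 _] := inputs_off o1 isT ig.
have E1 (i k : 'I_m) : g1 5%N i k = E i k by rewrite o1.
have c1 : g1 6%N 0%N 0%N = c0 by rewrite o1.
apply/wp_seq/wp_acc => //= [l i j lm im jn|g2 o2 e2].
  apply: leq_trans DL.
  apply: (reduced_bound (i := Ordinal im) (x := fun k => A k (Ordinal jn))
     (F := fun k => (0 - g1 6%N 0%N 0%N * g1 5%N i k) * g1 0%N (2 + (k * n + j))%N 0%N)) => //.
  by move=> k; rewrite c1 (E1 (Ordinal im)) (i1 k (Ordinal jn)) sub0r !mulNr.
have [_ i2' _] := inputs_off o2 isT (inputs_off o1 isT ig).
have E2 (i k : 'I_m) : g2 5%N i k = E i k by rewrite o2.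
have c2 : g2 6%N 0%N 0%N = c0 by rewrite o2.
apply/wp_acc => //= [l i j lm im jn|g3 o3 e3].
  apply: leq_trans DL.
  apply: (reduced_bound (i := Ordinal im) (x := fun k => b k 0)
     (F := fun k => (0 - g2 6%N 0%N 0%N * g2 5%N i k) * g2 0%N (2 + (m * n + k))%N 0%N)) => //.
  by move=> k; rewrite c2 (E2 (Ordinal im)) i2' sub0r !mulNr.
apply: hQ.
- apply: (same_off_trans (g2 := g1)); first exact: same_offW o1.
  by apply: (same_off_trans (g2 := g2)); [apply: same_offW o2|apply: same_offW o3].
- by rewrite o3 // o2 // e1 /= gc.
- move=> k j; rewrite o3 // e2 // !mxE mulr_sumr; apply: eq_bigr => l _.
  by rewrite c1 E1 i1 sub0r !mulNr mulrA.
move=> k; rewrite e3 // !mxE mulr_sumr; apply: eq_bigr => l _.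
by rewrite c2 E2 i2' sub0r !mulNr mulrA.
Qed.

Let leq_add_double x y : (x <= y -> x + y <= 2 * y)%N.
Proof. lia. Qed.

Lemma wp_output Q (g : arrays) (y := fun k : nat =>
    ((g 9%N k 0%N - \sum_(j < n) g 8%N k j * g 14%N j 0%N) %/ g 7%N 0%N 0%N)%Z) :
  inputs g ->
  (forall (k : 'I_m) (j : 'I_n), (`|g 8%N k j| <= D)%N) ->
  (forall k : 'I_m, (`|g 9%N k 0%N| <= D)%N) ->
  (forall j : 'I_n, (`|g 14%N j 0%N| <= D)%N) ->
  (forall g' : arrays, (forall j : 'I_n, g' 0%N j 0%N =
       g 14%N j 0%N + \sum_(k < m) (if f k == j then y k else 0)) -> Q g') ->
  wp L p_output env0 Q g.
Proof.
move=> [i1 i2 i3] b8 b9 b14 hQ.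
have b15 l k : (l <= n)%N -> (k < m)%N ->
    (`|(\sum_(j < l) g 8%N k j * g 14%N j 0%N)%R| <= U ^ (4 * m).+1)%N.
  move=> ln km.
  apply: leq_trans (absz_sum_le (F := fun j => g 8%N k j * g 14%N j 0%N) (b := (D * D)%N) _) _.
    move=> j jl; have jn := leq_trans jl ln.
    by rewrite abszM leq_mul ?(b8 (Ordinal km) (Ordinal jn)) ?(b14 (Ordinal jn)).
  rewrite -expnD expnS (_ : (2 * m + 2 * m = 4 * m)%N); last by lia.
  rewrite leq_mul2r; apply/orP; right; apply: leq_trans alU.
  by rewrite -[l]muln1 leq_mul // (leq_trans ln).
apply/wp_seq/wp_acc => //= [l k j ln km _|g1 o1 e1].
  by apply: leq_trans (b15 _ _ ln km) _; apply: leL; lia.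
have g1y (k : 'I_m) : ((g1 9%N k 0%N - g1 15%N k 0%N) %/ g1 7%N 0%N 0%N)%Z = y k.
  by rewrite e1 // !o1.
have ub k : (k < m)%N -> (`|y k| <= U ^ (4 * m).+2)%N.
  move=> km; apply: leq_trans (lez_div _ _) _.
  apply: (@leq_trans (D + U ^ (4 * m).+1)).
    apply: leq_trans (absz_add_le (b9 (Ordinal km)) _) (leqnn _).
    by rewrite abszN b15.
  rewrite [(U ^ _.+2)%N]expnS; apply: (@leq_trans (2 * U ^ (4 * m).+1)).
    by apply: leq_add_double; rewrite leq_pexp2l // ?(ltnW U1) //; lia.
  by rewrite leq_mul2r U1 orbT.
have y16 l j : (l <= m)%N ->
    (`|(\sum_(k < l) (if g1 0%N (2 + (m * n + (m + k)))%N 0%N - j%:Z == 0 then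
        ((g1 9%N k 0%N - g1 15%N k 0%N) %/ g1 7%N 0%N 0%N)%Z else 0))%R|
      <= U ^ (4 * m).+3)%N.
  move=> lm; apply: leq_trans (absz_sum_le (b := (U ^ (4 * m).+2)%N) (F := fun k : nat =>
     if g1 0%N (2 + (m * n + (m + k)))%N 0%N - j%:Z == 0 then
        ((g1 9%N k 0%N - g1 15%N k 0%N) %/ g1 7%N 0%N 0%N)%Z else 0) _) _.
    move=> k kl; case: ifP => // _; have km := leq_trans kl lm.
    by rewrite (g1y (Ordinal km)); apply: ub.
  rewrite [(U ^ _.+3)%N]expnS leq_mul2r; apply/orP; right; apply: leq_trans alU.
  by rewrite -[l]muln1 leq_mul // (leq_trans lm).
apply/wp_seq/wp_acc => //= [l j i lm jn _|g2 o2 e2].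
  by apply: leq_trans (y16 _ _ lm) _; apply: leL; lia.
have e16 (j : 'I_n) : g2 16%N j 0%N = \sum_(k < m) (if f k == j then y k else 0).
  rewrite e2 //; apply: eq_bigr => k _.
  by rewrite g1y o1 // i3 subr_eq0.
apply/wp_fill => /= [j i jn|g3 o3 e3].
  move=> _; rewrite (o2 14%N) // (o1 14%N) // e2 //.
  apply: leq_trans (absz_add_le (b14 (Ordinal jn)) (y16 _ _ (leqnn _))) _.
  apply: (@leq_trans (2 * U ^ (4 * m).+3)).
    by apply: leq_add_double; rewrite leq_pexp2l // ?(ltnW U1) //; lia.
  by apply: leq_trans (leL (leqnn _)); rewrite [(U ^ _.+4)%N]expnS leq_mul2r U1 orbT.
by apply: hQ => j; rewrite e3 ltn_ord /= e16 (o2 14%N) // (o1 14%N).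
Qed.

Definition natmx p q (M : 'M[int]_(p, q)) (i j : nat) : int :=
  if insub i is Some i' then if insub j is Some j' then M i' j' else 0 else 0.

Lemma natmxE p q (M : 'M[int]_(p, q)) (i : 'I_p) (j : 'I_q) : natmx M i j = M i j.
Proof. by rewrite /natmx !valK. Qed.

Hypothesis dB : \det B != 0.
Local Notation C := (natmx cmat).
Local Notation c := (fun k => natmx cvec k 0).
Local Notation tau := [set f i | i in 'I_m].

Let c0_neq0 : c0 != 0.
Proof. by have [_ _ ->] := fl_spec B. Qed.

Lemma cmod_gt0 : 0 < cmod.
Proof. by rewrite /cmod -expr2 lt_def sqr_ge0 sqrf_eq0 c0_neq0. Qed.

Lemma cmat_select (k l : 'I_m) : cmat k (f l) = cmod *+ (k == l).
Proof.
have [_ /matrixP /(_ k l) h _] := fl_spec B.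
have e : (E *m A) k (f l) = (E *m B) k l.
  by rewrite !mxE; apply: eq_bigr => i _; rewrite mxE.
by rewrite /cmat mxE e h mxE mulrnAr mulrNN.
Qed.

(** The multiplier [- c0 *: E] is non-singular, because its product with [B] is a nonzero scalar
    matrix, so it cancels. *)
Lemma cmat_solution (x : 'cV[int]_n) : A *m x = b <-> cmat *m x = cvec.
Proof.
have -> : cmat *m x = (- c0 *: E) *m (A *m x) by rewrite /cmat -!scalemxAl mulmxA.
have -> : cvec = (- c0 *: E) *m b by rewrite /cvec -scalemxAl.
split=> [->//|]; apply: mulmx_detI.
have [_ EB _] := fl_spec B.
have : \det ((- c0 *: E) *m B) != 0.
  by rewrite -scalemxAl EB scale_scalar_mx det_scalar expf_neq0 // mulf_neq0 // oppr_eq0.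
by rewrite det_mulmx; apply: contraNneq => ->; rewrite mul0r.
Qed.

Lemma cmat_row (x : 'cV[int]_n) (k : 'I_m) : cmat *m x = cvec ->
  natmx cvec k 0 = \sum_(j < n) C k j * x j 0.
Proof.
move=> /matrixP /(_ k 0) e; rewrite (natmxE _ k 0) -e mxE.
by apply: eq_bigr => j _; rewrite natmxE.
Qed.

(** Columns of tau vanish modulo [cmod], so the coordinates of an integer solution outside the
    reduced support may be set to 0. Its contrapositive transfers minimality back to the
    integers. *)
Lemma feasible_mod (S : nat -> int) (j : 'I_n) :
  feasible A b ([set i : 'I_n | S i != 0] :\ j :|: tau) ->
  mod_feasible m n cmod C c (without S j).
Proof.
move=> [x [/cmat_solution Cx x0]].
pose x' i := if without S j i == 0 then 0 else natmx x i 0.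
exists x'; split=> [i _ Si|k km]; first by rewrite /x' Si eqxx.
rewrite (cmat_row (Ordinal km) Cx) -sumrB rpred_sum // => i _.
rewrite -mulrBr /x'; case: eqP => [Si|_]; last first.
  by rewrite (natmxE x i 0) subrr mulr0 dvdz0.
rewrite subr0; have [iT|iT] := boolP (i \in tau); last first.
  rewrite x0 ?mulr0 ?dvdz0 // !inE (negbTE iT) orbF negb_and negbK.
  by move: Si; rewrite /without -[_ == _ :> nat]/(i == j); case: eqP => //= _ ->; rewrite eqxx.
have [l _ ->] := imsetP iT.
by rewrite (natmxE cmat (Ordinal km)) cmat_select dvdz_mulr // -mulr_natr dvdz_mulr.
Qed.

Lemma feasible_mod1 : (exists x : 'cV[int]_n, A *m x = b) ->
  mod_feasible m n cmod C c (fun=> 1).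
Proof.
move=> [x /cmat_solution Cx]; exists (fun j => natmx x j 0); split=> // k km.
rewrite (cmat_row (Ordinal km) Cx) -sumrB rpred_sum // => j _.
by rewrite (natmxE x j 0) subrr dvdz0.
Qed.

(** Coordinate [f k] of tau acts on row [k] only, with factor [cmod]; adding the defect divided by
    [cmod] there makes the congruences equalities. *)
Definition lifted (x : nat -> int) : 'cV[int]_n := \col_j
  (x j + \sum_k (if f k == j then
     ((natmx cvec (k : 'I_m) 0 - \sum_(i < n) C k i * x i) %/ cmod)%Z else 0)).

Lemma lift_solution S x : mod_solution m n cmod C c S x -> A *m lifted x = b.
Proof.
move=> [_ hx]; apply/cmat_solution/matrixP => k z; rewrite (ord1 z) {z} [LHS]mxE.
pose y (l : 'I_m) := ((natmx cvec l 0 - \sum_(i < n) C l i * x i) %/ cmod)%Z.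
transitivity (\sum_(j < n) C k j * x j + \sum_(l < m) cmat k (f l) * y l).
  rewrite (eq_bigr (fun j : 'I_n => C k j * x j +
     \sum_(l < m) (if f l == j then cmat k j * y l else 0))); last first.
    move=> j _; rewrite [lifted x j 0]mxE mulrDr natmxE mulr_sumr; congr (_ + _).
    by apply: eq_bigr => l _; case: ifP => _; rewrite ?mulr0.
  rewrite big_split /= exchange_big /=; congr (_ + _); apply: eq_bigr => l _.
  by rewrite -big_mkcond /= (bigD1 (f l)) //= big1 ?addr0 // => j /andP [/eqP ->]; rewrite eqxx.
rewrite (bigD1 k) //= [X in _ + (_ + X)]big1 ?addr0 => [|l lk]; last first.
  by rewrite cmat_select eq_sym (negbTE lk) mul0r.
rewrite cmat_select eqxx mulr1n mulrC divzK ?hx // addrC subrK.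
by rewrite (natmxE _ k 0).
Qed.

Lemma lift_support (S x : nat -> int) :
  (forall j, (j < n)%N -> S j = 0 -> x j = 0) ->
  forall j, j \notin [set i : 'I_n | S i != 0] :|: tau -> lifted x j 0 = 0.
Proof.
move=> hx j; rewrite !inE negb_or negbK mxE => /andP [/eqP Sj jt].
rewrite hx // big1 ?addr0 // => k _; case: eqP => // e.
by case/negP: jt; apply/imsetP; exists k.
Qed.

Lemma cmat_bound k j : (`|cmat k j| <= D)%N.
Proof.
pose F i := - c0 * natmx E k i * natmx A i j.
have -> : cmat k j = \sum_(i < m) F i.
  by rewrite !mxE mulr_sumr; apply: eq_bigr => i _; rewrite /F !natmxE mulrA.
by apply: (reduced_bound (i := k) (x := fun i => A i j)) => // i; rewrite /F !natmxE.
Qed.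

Lemma cvec_bound k : (`|cvec k 0%R| <= D)%N.
Proof.
pose F i := - c0 * natmx E k i * natmx b i 0%N.
have -> : cvec k 0 = \sum_(i < m) F i.
  by rewrite !mxE mulr_sumr; apply: eq_bigr => i _; rewrite /F natmxE (natmxE b i 0) mulrA.
by apply: (reduced_bound (i := k) (x := fun i => b i 0)) => // i; rewrite /F natmxE (natmxE b i 0).
Qed.

Lemma wp_main Q (g : arrays) : inputs g -> (exists x : 'cV[int]_n, A *m x = b) ->
  (forall (g' : arrays) (S : {set 'I_n}) (x : 'cV[int]_n),
     A *m x = b ->
     (forall j, j \notin S :|: tau -> x j 0 = 0) ->
     (forall j, j \in S -> ~ feasible A b (S :\ j :|: tau)) ->
     (forall j : 'I_n, g' 0%N j 0%N = x j 0) -> Q g') ->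
  wp L p_main env0 Q g.
Proof.
move=> ig fA hQ.
apply/wp_seq/wp_select => // g1 o1 B1.
have ig1 := inputs_off o1 isT ig.
apply/wp_seq/wp_adjugate => // g2 o2 E2 c2.
have ig2 := inputs_off o2 isT ig1.
apply/wp_seq/wp_reduce => // g3 o3 d3 C3 c3.
have ig3 := inputs_off o3 isT ig2.
have dD := cmod_bound.
have dat : data m n cmod C c g3.
  split=> // [k j km jn|k km].
    by rewrite (C3 (Ordinal km) (Ordinal jn)) -natmxE.
  by rewrite (c3 (Ordinal km)) -natmxE.
apply/wp_seq; apply: (wp_greedy cmod_gt0 dD _ _ dat (feasible_mod1 fA)).
- apply: (@leq_trans (U ^ (2 * m).+1)); last by apply: leL; lia.
  rewrite expnS leq_mul2r; apply/orP; right.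
  apply: (@leq_trans (2 * al)); first by rewrite mul2n -addnn -addn1 leq_add.
  by rewrite leq_mul2l /= -{1}[al]expn1 leq_pexp2l.
- apply: (@leq_trans (U ^ (4 * m).+1)); last by apply: leL; lia.
  by rewrite [leqRHS]expnS -expnM (_ : (2 * m * 2 = 4 * m)%N) ?leq_mul2r ?U1 ?orbT //; lia.
move=> g4 o4 S x b4 x4 sol4 min4.
have [g47 g48 g49] := data_off o4 isT dat.
have ig4 := inputs_off o4 isT ig3.
apply: wp_output => // [k j|k|j|g5 e5].
- by rewrite g48 // natmxE; apply: cmat_bound.
- by rewrite g49 // (natmxE cvec k 0); apply: cvec_bound.
- exact: x4.
have [xS _] := sol4.
apply: (hQ g5 [set i : 'I_n | S i != 0] (lifted x)).
- exact: lift_solution sol4.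
- exact: lift_support.
- move=> j; rewrite inE => Sj /feasible_mod; apply: min4 => //.
  by case: (b4 j (ltn_ord j)) => // h; rewrite h in Sj.
move=> j; rewrite e5 mxE; congr (_ + _); apply: eq_bigr => k _; case: ifP => // _.
rewrite g47 g49 // (eq_bigr (fun i : 'I_n => C k i * x i)) // => i _.
by rewrite g48.
Qed.

End Verify.

(** * Input, output and running time *)

Lemma nth_allpairs (S T : Type) (f : S -> T -> int) s t i j x0 y0 :
  (i < size s)%N -> (j < size t)%N ->
  nth 0 [seq f x y | x <- s, y <- t] (i * size t + j) = f (nth x0 s i) (nth y0 t j).
Proof.
move=> + jt; elim: s i => [|x s IH] [|i] //= hi; rewrite nth_cat size_map.
  by rewrite mul0n add0n jt (nth_map y0).
by rewrite mulSn -addnA ltnNge leq_addr /= addKn IH.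
Qed.

Section Encoding.
Variables (m n : nat) (A : 'M[int]_(m, n)) (b : 'cV[int]_m) (tau : {set 'I_n}).
Hypothesis taum : #|tau| = m.
Local Notation w := (encode_input A b tau).

Lemma nth_encodeA (i : 'I_m) (j : 'I_n) : nth 0 w (2 + (i * n + j)) = A i j.
Proof.
have ij : (i * n + j < m * n)%N.
  apply: (@leq_trans (i.+1 * n)); first by rewrite mulSn [leqRHS]addnC ltn_add2l.
  by rewrite leq_mul2r ltn_ord orbT.
rewrite /= add0n nth_cat size_allpairs !size_enum_ord ij.
have := @nth_allpairs _ _ (fun i j => A i j) (enum 'I_m) (enum 'I_n) i j i j.
by rewrite !size_enum_ord !nth_ord_enum => ->.
Qed.

Lemma nth_encodeb (i : 'I_m) : nth 0 w (2 + (m * n + i)) = b i 0.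
Proof.
rewrite /= add0n nth_cat size_allpairs !size_enum_ord ltnNge leq_addr /= addKn.
by rewrite nth_cat size_map size_enum_ord ltn_ord (nth_map i) ?size_enum_ord // nth_ord_enum.
Qed.

Lemma nth_encode_tau (k : 'I_m) j0 :
  nth 0 w (2 + (m * n + (m + k))) = (nth j0 (enum tau) k)%:Z.
Proof.
rewrite /= add0n nth_cat size_allpairs !size_enum_ord ltnNge leq_addr /= addKn.
rewrite nth_cat size_map size_enum_ord ltnNge leq_addr /= addKn.
by rewrite (nth_map j0) // -cardE taum.
Qed.

Lemma size_encode : size w = (2 + (m * n + (m + m)))%N.
Proof.
rewrite /encode_input !size_cat size_allpairs !size_enum_ord.
by rewrite (size_map (fun i => b i 0)) (size_map (fun j => (val j)%:Z)) size_enum_ord -cardE taum.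
Qed.

End Encoding.

Lemma absz_le_bitsize (w : seq int) k : (`|nth 0%R w k| <= 2 ^ bitsize w)%N.
Proof.
have [kw|kw] := ltnP k (size w); last by rewrite nth_default.
have : (bitlen (nth 0%R w k) <= bitsize w)%N.
  by rewrite /bitsize (big_rem (nth 0 w k)) ?mem_nth //= leq_addr.
move=> h; apply: leq_trans (leq_pexp2l _ h) => //.
apply: leq_trans (ltnW (trunc_log_ltn _ (ltnSn 1))) _.
by rewrite leq_pexp2l.
Qed.

Lemma size_le_bitsize (w : seq int) : (size w <= bitsize w)%N.
Proof. by rewrite /bitsize -sum1_size leq_sum. Qed.

Definition setup : cmd :=
  Seq (Assign (var 0) (Get (Cst 0)))
  (Seq (Assign (var 1) (Get (Cst 1)))
  (Seq (Assign (var 2) (Bin Add (Get (var 0)) (Get (var 1))))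
  (Seq (Assign (var 3) (Bin Add (Get (var 1)) (Cst 2)))
       (Assign (var 4) (Cst 1))))).

Definition tsetup (L : nat) : nat :=
  (tassign (var 0) (Get (Cst 0)) L + (tassign (var 1) (Get (Cst 1)) L +
  (tassign (var 2) (Bin Add (Get (var 0)) (Get (var 1))) L +
  (tassign (var 3) (Bin Add (Get (var 1)) (Cst 2)) L +
   tassign (var 4) (Cst 1) L))))%N.

Lemma runs_setup L (m n : nat) s : (0 < L)%N -> bounded L s ->
  s 0 = m%:Z -> s 1 = n%:Z -> (m + n <= 2 * L)%N -> (n + 2 <= 2 * L)%N ->
  runs setup s (tsetup L) (fun s' => [/\ repv [:: m; n; (m + n)%N; n.+2; 1%N] s',
    bounded L s' & forall r i j, r != 1%N -> s' (cell r i j) = s (cell r i j)]).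
Proof.
move=> L0 bs s0 s1 mnL nL.
have vL (v : nat) : (v <= 2 * L)%N -> (`|v%:Z| <= 2 ^ L)%N by apply: leq_var.
pose J env s' := [/\ repv env s', bounded L s' &
  forall r i j, r != 1%N -> s' (cell r i j) = s (cell r i j)].
have step env (k : nat) e s' : J env s' -> eval s' e = k%:Z -> (k <= 2 * L)%N ->
    runs (Assign (var (size env)) e) s' (tassign (var (size env)) e L) (J (rcons env k)).
  move=> [v1 b1 k1] ek kL; apply: runs_assign => //; rewrite /= ek; split.
  - by apply: repv_rcons; [apply: repvV|rewrite /= eqxx].
  - by apply: boundedU => //; apply: vL.
  by move=> r i j r1 /=; rewrite cell_neq ?k1.
have J0 : J [::] s by [].
have c0 s' env : J env s' -> s' (cell 0 0 0) = m%:Z by case=> _ _ ->.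
have c1 s' env : J env s' -> s' (cell 0 1 0) = n%:Z by case=> _ _ ->.
apply: runs_seq; first by apply: (step _ m _ _ J0); [apply: c0 J0|lia].
move=> s2 J2; apply: runs_seq; first by apply: (step _ n _ _ J2); [apply: c1 J2|lia].
move=> s3 J3; have v3 := J3; case: v3 => v3 _ _; apply: runs_seq.
  by apply: (step _ (m + n)%N _ _ J3) => //=; rewrite (v3 0%N) // (v3 1%N).
move=> s4 J4; have v4 := J4; case: v4 => v4 _ _; apply: runs_seq.
  by apply: (step _ n.+2 _ _ J4) => /=; [rewrite (v4 1%N) //=; lia|lia].
by move=> s5 J5; apply: (step _ 1%N _ _ J5) => //; lia.
Qed.

Lemma sparse_solution_of_minimal m n (A : 'M[int]_(m, n)) b (tau S : {set 'I_n}) x :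
  (m <= n)%N -> #|tau| = m -> minor A tau != 0 -> A *m x = b ->
  (forall j, j \notin S :|: tau -> x j 0 = 0) ->
  (forall j, j \in S -> ~ feasible A b (S :\ j :|: tau)) ->
  sparse_solution A b tau x.
Proof.
move=> mn taum dA Ax xS Smin; split=> //.
have := minimal_support_card mn taum dA (ex_intro _ x (conj Ax xS)) Smin.
rewrite -(leq_add2l m) -{1}taum; apply: leq_trans.
apply: leq_trans (leq_card_setU _ _); rewrite setUC; apply: subset_leq_card.
by apply/subsetP => j; rewrite inE; apply: contraR => /xS ->.
Qed.

Definition solver : cmd := Seq setup (compile 5 p_main).

(* All values are at most growth (2 ^ s) ^ (4 * m + 4), where m <= s. *)
Definition word_length (s : nat) : nat := ((3 * s + 1) * (4 * s + 4))%N.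

Lemma solver_correct m n (A : 'M[int]_(m, n)) (b : 'cV[int]_m) (tau : {set 'I_n}) L :
  L = word_length (bitsize (encode_input A b tau)) ->
  (0 < m)%N -> (m <= n)%N -> #|tau| = m -> minor A tau != 0 ->
  (exists x : 'cV[int]_n, A *m x = b) ->
  exists x : 'cV[int]_n, sparse_solution A b tau x /\
    computes_within solver (encode_input A b tau) (tsetup L + time 5 p_main L)
      (encode_vector x).
Proof.
case: m A b tau => // m' A b tau; set w := encode_input A b tau.
set s := bitsize w => eL _ mn taum dA fA.
have [f [etau ftau] eA] := minorE A taum.
have sw : (2 + (m'.+1 * n + (m'.+1 + m'.+1)) <= s)%N.
  by rewrite -(size_encode A b taum) size_le_bitsize.
have ns : (m'.+1 + n + 2 <= s)%N by nia.
have Ls : (s <= L)%N by rewrite eL /word_length; nia.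
have s2 : (s < 2 ^ s)%N by apply: ltn_expl.
have L0 : (0 < L)%N by lia.
have absw k : (`|nth 0%R w k| <= 2 ^ s)%N by apply: absz_le_bitsize.
have b0 : bounded L (init_store w).
  move=> a; apply: (@leq_trans (2 ^ s)); last by rewrite leq_pexp2l.
  by case: a => // k; apply: absw.
have [t0 [s0 [x0 l0 [v0 bs0 k0]]]] :=
  runs_setup (m := m'.+1) (n := n) L0 b0 erefl erefl ltac:(lia) ltac:(lia).
pose g : arrays := fun r i j => s0 (cell (reg r) i j).
have g0 k : g 0%N k 0%N = nth 0 w k by rewrite /g k0.
have ig : inputs A b f g.
  split=> *; rewrite g0; first exact: nth_encodeA.
    exact: nth_encodeb.
  by rewrite (nth_encode_tau _ _ taum _ (f ord0)) -ftau.
pose Q (g' : arrays) := exists x : 'cV[int]_n, sparse_solution A b tau x /\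
   forall j : 'I_n, g' 0%N j 0%N = x j 0.
have wpQ : wp L p_main [:: m'.+1; n; (m'.+1 + n)%N; n.+2; 1%N] Q g.
  (* [2 ^ s] bounds the entries of the input, and also [m] and [n], which are at most the input size
     [s]. *)
  apply: (wp_main (al := 2 ^ s) (f := f) _ _ _ _ _ _ ig fA).
  - by move=> i j; rewrite -(nth_encodeA A b tau).
  - by move=> i; rewrite -(nth_encodeb A b tau).
  - lia.
  - lia.
  (* With [al = 2 ^ s] the growth factor is [2 ^ (3 * s + 1)], the origin of the first factor of
     [word_length]. *)
  - rewrite /growth -expnM -expnS -expnM leq_pexp2l // eL /word_length.
    nia.
  - by rewrite -eA.
  rewrite -etau => g' S x Ax xS Smin e; exists x; split=> //.
  exact: sparse_solution_of_minimal xS Smin.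
have [|t1 [s1 [x1 l1 [_ _ [g' mg [x [sx gx]]]]]]] :=
  compile_correct L0 _ v0 (fun r i j => erefl : s0 (cell (reg r) i j) = g r i j) bs0 wpQ.
  by rewrite /=; lia.
exists x; split=> //; exists (t0 + t1)%N, s1; split; first exact: exec_seq x0 x1.
  exact: leq_add.
move=> k; rewrite size_map size_enum_ord => kn.
rewrite (nth_map (Ordinal kn)) ?size_enum_ord // (nth_ord_enum _ (Ordinal kn)) -gx.
(* Column 0 of array 0 occupies the addresses 0, 1, ..., where the output is read. *)
exact: (mg 0%N k 0%N).
Qed.

Theorem corollary2 :
  (forall (m n : nat) (A : 'M[int]_(m, n)) (b : 'cV[int]_m) (tau : {set 'I_n}),
     (0 < m)%N -> (m <= n)%N -> #|tau| = m -> minor A tau != 0 ->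
     (exists x : 'cV[int]_n, A *m x = b) ->
     exists x : 'cV[int]_n, sparse_solution A b tau x)
  /\
  (exists (P : cmd) (p : {poly nat}),
     forall (m n : nat) (A : 'M[int]_(m, n)) (b : 'cV[int]_m) (tau : {set 'I_n}),
     (0 < m)%N -> (m <= n)%N -> #|tau| = m -> minor A tau != 0 ->
     (exists x : 'cV[int]_n, A *m x = b) ->
     exists x : 'cV[int]_n,
       sparse_solution A b tau x /\
       computes_within P (encode_input A b tau)
         p.[bitsize (encode_input A b tau)] (encode_vector x)).
Proof.
split=> [m n A b tau m0 mn taum dA fA|].
  by have [x [sx _]] := solver_correct erefl m0 mn taum dA fA; exists x.
have [p hp] : poly_bounded (fun L => tsetup L + time 5 p_main L)%N.
  apply: poly_boundedD (poly_bounded_time _ _).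
  have A a e : poly_bounded (tassign a e).
    by apply: poly_boundedM; [apply: poly_bounded_cst|apply: poly_bounded_id].
  by do !apply: poly_boundedD => //.
have [q hq] : poly_bounded word_length.
  have C := poly_bounded_cst; have X := poly_bounded_id.
  by apply: poly_boundedM; apply: poly_boundedD => //; apply: poly_boundedM.
(* Time is polynomial in the word length, and the word length in the input size; composing the two
   bounds uses that polynomials over [nat] are monotone. *)
exists solver, (p \Po q) => m n A b tau m0 mn taum dA fA.
have [x [sx [t [s [x1 l1 h1]]]]] := solver_correct erefl m0 mn taum dA fA.
exists x; split=> //; exists t, s; split=> //.
rewrite horner_comp; apply: leq_trans l1 (leq_trans (hp _) _).
exact: horner_nat_homo.
Qed.
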